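(* Let $p\geq 5$ be a prime, let $S$ be a Sylow $p$-subgroup of the group $\mathrm{G}_2(p)$ and let $\mathcal{F}$ be a saturated fusion system on $S$. Suppose $Q\leq S$ is not $\mathcal{F}$-centric and $V$ is a simple $\mathbb{F}_p\mathrm{Out}_{\mathcal{F}}(Q)$-module. Then for all $\mathcal{F}$-centric subgroups $P,R\leq S$ such that their intersection $T=P\cap R$ is not $\mathcal{F}$-centric, the composition $$S_{Q,V}(P)\xrightarrow{\mathrm{Res}_T^P} S_{Q,V}(T)\xrightarrow{\mathrm{Ind}_T^R} S_{Q,V}(R)$$ is zero.
   Context: $\mathrm{G}_2(p)$ is the finite group of Lie type $\mathrm{G}_2$ over the field $\mathbb{F}_p$. A subgroup $P\leq S$ is $\mathcal{F}$-centric if $C_S(P')\leq P'$ for every $P'\le S$ that is $\mathcal{F}$-conjugate to $P$. $\mathrm{Out}_{\mathcal F}(P)=\mathrm{Aut}_{\mathcal F}(P)/\mathrm{Inn}(P)$. Write ${}^xL=xLx^{-1}$ and $c_x$ for conjugation $g\mapsto xgx^{-1}$. The Mackey functor $S_{Q,V}$ (for $\mathcal F$ a saturated fusion system on a finite $p$-group $S$, $Q\leq S$, $V$ a left $\mathbb{F}_p\mathrm{Out}_{\mathcal F}(Q)$-module). For an $\mathcal F$-isomorphism $\alpha:Q\to L$, ${}^\alpha V$ is the vector space $V$ made into an $\mathbb{F}_p\mathrm{Out}_{\mathcal F}(L)$-module by $[\gamma]\cdot v:=[\alpha^{-1}\gamma\alpha]v$. A subgroup $N\leq N_S(L)$ acts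 on ${}^\alpha V$ through $N\to\mathrm{Aut}_{\mathcal F}(L)\to\mathrm{Out}_{\mathcal F}(L)$, $x\mapsto[c_x|_L]$. For $L\le H\leq N\leq N_S(L)$ the relative trace is $\mathrm{tr}_H^N(v)=\sum_{x\in[N/H]}x\cdot v$, for $v$ fixed by $H$. For each $L\leq S$ that is $\mathcal F$-conjugate to $Q$ fix an $\mathcal F$-isomorphism $\alpha=\alpha_L:Q\to L$. For an $\mathcal F$-isomorphism $\varphi:L_1\to L_2$ between such subgroups, $\mathrm{Iso}(\varphi):{}^{\alpha_1}V\to{}^{\alpha_2}V$ is $v\mapsto[\alpha_2^{-1}\varphi\alpha_1]\cdot v$. For $P\leq S$ put $V_{\alpha,L}(P):=\mathrm{tr}_L^{N_P(L)}({}^\alpha V)$ for $L\le P$ that is $\mathcal F$-conjugate to $Q$, and $S_{Q,V}(P):=\bigoplus_L V_{\alpha,L}(P)$, the sum being over representatives of the $P$-conjugacy classes of subgroups $L\leq P$ that are $\mathcal F$-conjugate to $Q$ (different choices of representatives or of the isomorphisms $\alpha$ are identified through the maps $\mathrm{Iso}$ induced by conjugation by elements of $P$, respectively through $v\mapsto[\alpha'^{-1}\alpha]v$). For $P\leq R\leq S$: - $\mathrm{Ind}_P^R:S_{Q,V}(P)\to S_{Q,V}(R)$ is given on each summand by $V_{\alpha,L}(P)\to V_{\alpha,L}(R)$, $v\mapsto\mathrm{tr}_{N_P(L)}^{N_R(L)}(v)$. - $\mathrm{Res}_P^R:S_{Q,V}(R)\to S_{Q,V}(P)$ is given on the summand $V_{\alpha,L}(R)$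 as follows: it is zero if no $R$-conjugate of $L$ lies in $P$; otherwise let $L_i={}^{r_i}L$ ($r_i\in R$, $1\le i\le k$) be representatives of the $P$-conjugacy classes of $R$-conjugates of $L$ contained in $P$, let $\beta_i=c_{r_i}\circ\alpha$, and map $V_{\alpha,L}(R)\to V_{\beta_1,L_1}(P)\oplus\cdots\oplus V_{\beta_k,L_k}(P)$ by the diagonal $v\mapsto v+\cdots+v$. *)

(* Defs.v *)
From mathcomp Require Import all_boot all_order all_algebra all_fingroup.
From mathcomp Require Import all_solvable all_character.

Set Implicit Arguments.
Unset Strict Implicit.
Unset Printing Implicit Defensive.

Import GroupScope GRing.Theory.

Section ZornVectorMatrices.

Variable F : fieldType.
Local Open Scope ring_scope.

Definition dotv (u v : 'rV[F]_3) : F := \sum_i u 0 i * v 0 i.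

(* The indices i + 1 and i + 2 are taken modulo 3. *)
Definition crossv (u v : 'rV[F]_3) : 'rV[F]_3 :=
  \row_i (u 0 (i + 1) * v 0 (i + 2) - u 0 (i + 2) * v 0 (i + 1)).

(* The split octonion algebra over F, as the algebra of Zorn vector matrices
     [ a  u ]
     [ v  b ]      (a, b in F and u, v in F^3),
   such a matrix being stored as the row vector (a, u, v, b). *)
Definition zorn : Type := 'rV[F]_(1 + 3 + (3 + 1)).

Definition mk_zorn (a : F) (u v : 'rV[F]_3) (b : F) : zorn :=
  row_mx (row_mx a%:M u) (row_mx v b%:M).

Definition zorn_a (x : zorn) : F := lsubmx (lsubmx x) 0 0.
Definition zorn_u (x : zorn) : 'rV[F]_3 := rsubmx (lsubmx x).
Definition zorn_v (x : zorn) : 'rV[F]_3 := lsubmx (rsubmx x).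
Definition zorn_b (x : zorn) : F := rsubmx (rsubmx x) 0 0.

(* The multiplicative norm form is ab - u.v. *)
Definition zorn_mul (x y : zorn) : zorn :=
  mk_zorn
    (zorn_a x * zorn_a y + dotv (zorn_u x) (zorn_v y))
    (zorn_a x *: zorn_u y + zorn_b y *: zorn_u x
       - crossv (zorn_v x) (zorn_v y))
    (zorn_a y *: zorn_v x + zorn_b x *: zorn_v y
       + crossv (zorn_u x) (zorn_u y))
    (zorn_b x * zorn_b y + dotv (zorn_v x) (zorn_u y)).

End ZornVectorMatrices.

(* G_2(p) is the group of F_p-algebra automorphisms of the split octonion
   algebra over F_p, acting on row vectors from the right. *)
Section G2.

Variable p : nat.

Definition G2 : {set {'GL_8['F_p]}} :=
  [set g : {'GL_8['F_p]} |
    [forall x : 'rV['F_p]_8, forall y : 'rV['F_p]_8,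
      zorn_mul (x *m GLval g) (y *m GLval g) == zorn_mul x y *m GLval g]]%R.

Lemma G2_group_set : group_set G2.
Proof.
apply/group_setP; split=> [|g h].
  by rewrite inE; apply/forallP=> x; apply/forallP=> y; rewrite !mulmx1.
rewrite !inE => /forallP gP /forallP hP.
apply/forallP=> x; apply/forallP=> y; rewrite !mulmxA.
have /forallP/(_ (y *m GLval g)%R)/eqP -> := hP (x *m GLval g)%R.
by have /forallP/(_ y)/eqP -> := gP x.
Qed.

Canonical G2_group := Group G2_group_set.

End G2.

Section FusionSystems.

Variable gT : finGroupType.
Implicit Types (P R L S : {group gT}) (f : gT -> gT) (x : gT).

(* Left conjugation c_x : g |-> x g x^-1; correspondingly the conjugate xLx^-1
   of a subgroup L is L :^ x^-1, since MathComp's g ^ x is x^-1 g x. *)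
Definition lconj x : gT -> gT := fun g => x * g * x^-1.

(* The inverse, defined on f @: P, of a map f that is injective on P. *)
Definition inv_on (P : {set gT}) f : gT -> gT :=
  fun y => odflt 1 [pick x in P | f x == y].

(* The element of Aut P (a permutation of gT fixing every point outside P) that
   agrees on P with a map f restricting to an automorphism of P. *)
Definition to_aut (P : {set gT}) f : {perm gT} :=
  odflt 1 [pick a in Aut P | [forall x in P, a x == f x]].

(* A morphism P -> R is represented by any function gT -> gT restricting to it
   on P; fhom P R is the set Hom_F(P, R), empty unless P, R are subgroups
   of S. *)
Record fusion_system S := FusionSystem {
  fhom :> {group gT} -> {group gT} -> pred (gT -> gT);
  fhom_sub : forall P R f, fhom P R f -> P \subset S /\ R \subset S;
  fhom_ext : forall P R f g, {in P, f =1 g} -> fhom P R f -> fhom P R g;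
  fhom_inj : forall P R f, fhom P R f ->
    [/\ {in P &, {morph f : x y / x * y}}, {in P &, injective f}
      & f @: P \subset R];
  fhom_conj : forall P R x, P \subset S -> R \subset S -> x \in S ->
    lconj x @: P \subset R -> fhom P R (lconj x);
  fhom_comp : forall P R T f g,
    fhom P R f -> fhom R T g -> fhom P T (g \o f);
  (* every morphism is an F-isomorphism onto its image *)
  fhom_iso : forall P R L f, fhom P R f -> L :=: f @: P ->
    fhom P L f /\ fhom L P (inv_on P f)
}.

Section Theory.

Variables (S : {group gT}) (F : fusion_system S).

Definition fiso P R f : bool := F P R f && (f @: P == R).

Definition fconj P R : bool := [exists f : {ffun gT -> gT}, fiso P R f].

Definition centric P : bool :=
  [forall R : {group gT}, fconj P R ==> ('C_S(R) \subset R)].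

(* Aut_F(P); the value for P not contained in S, where there are no morphisms,
   is irrelevant and only makes AutF P a group for every P. *)
Definition AutF P : {set {perm gT}} :=
  [set a in Aut P | (P \subset S) ==> F P P a].

Lemma AutF_group_set P : group_set (AutF P).
Proof.
apply/group_setP; split=> [|a b].
  apply/setIdP; split=> //; apply/implyP=> sPS.
  apply: (@fhom_ext _ _ _ _ (lconj 1)) => [x _|].
    by rewrite perm1 /lconj mul1g invg1 mulg1.
  apply: fhom_conj => //; apply/subsetP=> _ /imsetP[x Px ->].
  by rewrite /lconj mul1g invg1 mulg1.
move=> /setIdP[Aa Fa] /setIdP[Ab Fb]; apply/setIdP; split; first exact: groupM.
apply/implyP=> sPS; rewrite sPS /= in Fa Fb.
by apply: fhom_ext (fhom_comp Fa Fb) => x _; rewrite /= permM.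
Qed.

Canonical AutF_group P := Group (AutF_group_set P).

Definition Inn P : {set {perm gT}} := conj_aut P @* P.
Canonical Inn_group P := [group of Inn P].

Definition AutS P : {set {perm gT}} := conj_aut P @* 'N_S(P).

(* In {perm gT} the product a * b is "a, then b", that is b \o a, so OutF P is
   the opposite of Out_F(P) for composition of maps. *)
Definition OutF P : {set coset_of (Inn P)} := AutF P / Inn P.
Canonical OutF_group P := [group of OutF P].

Definition fully_automised (p : nat) P : bool :=
  p.-Sylow(AutF P) (AutS P).

(* N_f = {g in N_S(R) | f c_g f^-1 in Aut_S(P)}, for f : R -> P. *)
Definition ext_dom R P f : {set gT} :=
  [set g in 'N_S(R) | to_aut P (f \o lconj g \o inv_on R f) \in AutS P].

(* ext_dom R P f is already a subgroup, <<_>> only turns it into a group. *)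
Definition receptive P : Prop :=
  forall R f, fiso R P f ->
    exists2 g, F <<ext_dom R P f>>%G S g & {in R, f =1 g}.

Definition saturated (p : nat) : Prop :=
  forall P, P \subset S ->
    exists R, [/\ fconj P R, fully_automised p R & receptive R].

Section Mackey.

Variables (p : nat) (Q : {group gT}) (n : nat).
Variable rV : mx_representation 'F_p (OutF Q) n.
Local Notation V := 'rV['F_p]_n.

(* [f].v for f in Aut_F(Q). As the product of OutF Q is reversed composition,
   the right action of OutF Q on row vectors is a left action of Out_F(Q). *)
Definition out_act (f : gT -> gT) (v : V) : V :=
  (v *m rV (coset (Inn Q) (to_aut Q f)))%R.

Definition fclass P : {set {group gT}} :=
  [set L : {group gT} | (L \subset P) && fconj Q L].

(* alpha L is the chosen isomorphism Q -> L, and X P the chosen set of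
   representatives of the P-classes of subgroups of P that are F-conjugate
   to Q. *)
Variables (alpha : {group gT} -> gT -> gT) (X : {group gT} -> {set {group gT}}).

Definition mackey_choice : Prop :=
  (forall L, fconj Q L -> fiso Q L (alpha L)) /\
  (forall P, P \subset S ->
     is_transversal (X P) (orbit 'JG%act P @: fclass P) (fclass P)).

(* Iso(f) : ^alpha1 V -> ^alpha2 V, for an F-isomorphism f : L1 -> L2. *)
Definition Iso (L1 L2 : {group gT}) (f : gT -> gT) (v : V) : V :=
  out_act (inv_on Q (alpha L2) \o f \o alpha L1) v.

(* x.v for x in N_S(L) and v in ^alpha V, where alpha = alpha L. *)
Definition act_on L (x : gT) (v : V) : V :=
  out_act (inv_on Q (alpha L) \o lconj x \o alpha L) v.

(* tr_H^N on ^alpha V; lcosets H N is the set of the cosets xH, x in N. *)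
Definition rtrace L (H N : {set gT}) (v : V) : V :=
  (\sum_(C in lcosets H N) act_on L (repr C) v)%R.

(* V_{alpha,L}(P); L itself acts trivially on ^alpha V, so every v is fixed. *)
Definition tr_space L P : {set V} := [set rtrace L L 'N_P(L) v | v : V].

(* S_{Q,V}(P): families of elements of the V_{alpha,L}(P), for L in X P,
   extended by 0 to all other subgroups. *)
Definition SQV P : {set {ffun {group gT} -> V}} :=
  [set s : {ffun {group gT} -> V} |
    [forall L, if L \in X P then s L \in tr_space L P else s L == 0%R]].

(* Some r in R with rLr^-1 = M. It is only used to apply Iso(c_r) to vectors
   fixed by N_R(L), so its choice is immaterial. *)
Definition conj_elt R L M : gT :=
  odflt 1 [pick r in R | L :^ r^-1 == M].

(* v in the summand at L in X P goes to its trace in V_{alpha,L}(R), which is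
   identified with the summand at the representative M in X R of the R-class of
   L through Iso(c_r), where M = rLr^-1 and r is in R. *)
Definition Ind P R (s : {ffun {group gT} -> V}) : {ffun {group gT} -> V} :=
  [ffun M => if M \in X R then
     \sum_(L in X P | M \in orbit 'JG%act R L)
       Iso L M (lconj (conj_elt R L M)) (rtrace L 'N_P(L) 'N_R(L) (s L))
   else 0]%R.

(* v in the summand at L in X R has a component in the summand at every M in
   X P of the form M = rLr^-1, r in R. This component is v as an element of
   V_{beta,M}(P), beta = c_r alpha_L, hence is alpha_M^-1 beta . v = Iso(c_r) v
   in V_{alpha_M,M}(P). The sum has exactly one term if M is in X P. *)
Definition Res R P (s : {ffun {group gT} -> V}) : {ffun {group gT} -> V} :=
  [ffun M => if M \in X P then
     \sum_(L in X R | M \in orbit 'JG%act R L)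
       Iso L M (lconj (conj_elt R L M)) (s L)
   else 0]%R.

End Mackey.

End Theory.

End FusionSystems.

(* Main.v *)
(* The composition is computed one subgroup M of T = P :&: R at a time, where M
   is F-conjugate to Q, hence not F-centric. Restriction to M yields vectors
   that are traces from M to N_P(M), so they vanish if C_P(M) is not contained
   in M. The trace from N_T(M) to N_R(M) vanishes if some y in N_R(M) outside P
   acts on M like an element x of N_P(M), because then it starts with a trace
   over a nontrivial p-group acting trivially. It remains to see that one of
   the two always happens.
     S is the semidirect product of F_p = <x_a> with an extraspecial group Q2 of
   order p^5, F_p acting on Q2 / Z(S) as on binary cubics. Let Q1 = C_S(Z_2(S)).
   If g lies in neither Q1 nor Q2 then |C_S(g)| = p^2 and the g-invariant
   subgroups of Q2 form a chain. Hence subgroups of order at least p^3 not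
   contained in Q1 or Q2 are F-centric: by downward induction on the order,
   extending isomorphisms to normalizers by saturation, being contained in
   neither is invariant under F-conjugacy. Abelian subgroups of order at least
   p^3 are also self-centralizing, so F-centric. If C_P(M) and C_R(M) are
   contained in M, these facts leave only M = Z_2(S), where P and R are M
   extended by one element outside Q1 = C_S(M), and x, y can be chosen. *)

Require Import Defs.
From mathcomp Require Import all_boot all_order all_algebra all_fingroup.
From mathcomp Require Import all_solvable all_character.
From mathcomp Require Import finfield ring.

Set Implicit Arguments.
Unset Strict Implicit.
Unset Printing Implicit Defensive.

Import GroupScope GRing.Theory.

(** * Unipotent automorphisms of the split octonions *)

Section ZornCoordinates.

Variable F : fieldType.
Local Open Scope ring_scope.

(** The order of G2(p) is never computed. An explicit six-parameter unipotent group is Sylow because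
    it contains every p-element of G2(p) normalizing it. Its parameters give coordinates on every
    Sylow subgroup in which the group law is polynomial, so commutators and centralizers become
    equations over F_p. The condition p >= 5 enters through the invertibility of 2 and 3 in these
    equations. The obstacle in the fusion part is that F is arbitrary: its isomorphisms are not
    known to preserve Q1, Q2 or the central subgroups. What they do preserve is commutativity,
    orders, and orders of centralizers taken inside a subgroup. In a subgroup of order at least p^4
    that contains an element outside Q1 and Q2, those elements are exactly the ones with centralizer
    of order at most p^2. A subgroup of order p^3 may be too small for this test, which is why it is
    applied to normalizers. The case analysis on P, R and M takes F-centricity as an abstract
    predicate and so uses only the structure of S. *)

Definition zv (a u0 u1 u2 v0 v1 v2 b : F) : 'rV[F]_8 :=
  \row_i [:: a; u0; u1; u2; v0; v1; v2; b]`_i.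

Lemma zvP (x : 'rV[F]_8) : exists a u0 u1 u2 v0 v1 v2 b,
  x = zv a u0 u1 u2 v0 v1 v2 b.
Proof.
pose c k : F := x 0 (inord k).
exists (c 0%N), (c 1%N), (c 2%N), (c 3%N), (c 4%N), (c 5%N), (c 6%N), (c 7%N).
apply/rowP=> i; rewrite mxE (_ : x 0 i = c i); last by rewrite /c inord_val.
by case: i => -[|[|[|[|[|[|[|[|[]]]]]]]]].
Qed.

Lemma zv_inj a u0 u1 u2 v0 v1 v2 b a' u0' u1' u2' v0' v1' v2' b' :
  zv a u0 u1 u2 v0 v1 v2 b = zv a' u0' u1' u2' v0' v1' v2' b' ->
  [/\ [/\ a = a', u0 = u0', u1 = u1' & u2 = u2'],
      v0 = v0', v1 = v1', v2 = v2' & b = b'].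
Proof.
move=> /rowP E.
have {}E k : (k < 8)%N -> [:: a; u0; u1; u2; v0; v1; v2; b]`_k =
    [:: a'; u0'; u1'; u2'; v0'; v1'; v2'; b']`_k.
  by move=> k8; have := E (Ordinal k8); rewrite !mxE.
by do !split; [exact: (E 0%N)|exact: (E 1%N)|exact: (E 2%N)|exact: (E 3%N)
  |exact: (E 4%N)|exact: (E 5%N)|exact: (E 6%N)|exact: (E 7%N)].
Qed.

Lemma zvD a u0 u1 u2 v0 v1 v2 b a' u0' u1' u2' v0' v1' v2' b' :
  zv a u0 u1 u2 v0 v1 v2 b + zv a' u0' u1' u2' v0' v1' v2' b' =
  zv (a + a') (u0 + u0') (u1 + u1') (u2 + u2')
     (v0 + v0') (v1 + v1') (v2 + v2') (b + b').
Proof.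
apply/rowP=> i; rewrite !mxE.
by case: i => -[|[|[|[|[|[|[|[|[]]]]]]]]].
Qed.

Lemma zvZ k a u0 u1 u2 v0 v1 v2 b :
  k *: zv a u0 u1 u2 v0 v1 v2 b =
  zv (k * a) (k * u0) (k * u1) (k * u2) (k * v0) (k * v1) (k * v2) (k * b).
Proof.
apply/rowP=> i; rewrite !mxE.
by case: i => -[|[|[|[|[|[|[|[|[]]]]]]]]].
Qed.

Definition row3 (c0 c1 c2 : F) : 'rV[F]_3 := \row_i [:: c0; c1; c2]`_i.

Lemma row3P (x : 'rV[F]_3) c0 c1 c2 :
  x 0 0 = c0 -> x 0 1 = c1 -> x 0 2 = c2 -> x = row3 c0 c1 c2.
Proof.
move=> E0 E1 E2; apply/rowP=> i; rewrite mxE.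
case: i => -[|[|[|[]]]] // h /=; rewrite -?E0 -?E1 -?E2;
  by congr (x _ _); apply: val_inj.
Qed.

Lemma zvE a u0 u1 u2 v0 v1 v2 b :
  zv a u0 u1 u2 v0 v1 v2 b = mk_zorn a (row3 u0 u1 u2) (row3 v0 v1 v2) b.
Proof.
rewrite /mk_zorn; set x := zv _ _ _ _ _ _ _ _.
rewrite -[LHS](@hsubmxK _ 1 (1 + 3) (3 + 1)).
apply: (f_equal2 (@row_mx F 1 (1 + 3) (3 + 1))).
  rewrite -[LHS](@hsubmxK _ 1 1 3); apply: (f_equal2 (@row_mx F 1 1 3)).
- by apply/rowP=> i; rewrite ord1 !mxE.
- by apply: row3P; rewrite !mxE.
rewrite -[LHS](@hsubmxK _ 1 3 1); apply: (f_equal2 (@row_mx F 1 3 1)).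
- by apply: row3P; rewrite !mxE.
- by apply/rowP=> i; rewrite ord1 !mxE.
Qed.

Lemma zorn_mulE a u0 u1 u2 v0 v1 v2 b a' u0' u1' u2' v0' v1' v2' b' :
  zorn_mul (zv a u0 u1 u2 v0 v1 v2 b) (zv a' u0' u1' u2' v0' v1' v2' b') =
  zv (a * a' + (u0 * v0' + u1 * v1' + u2 * v2'))
     (a * u0' + b' * u0 - (v1 * v2' - v2 * v1'))
     (a * u1' + b' * u1 - (v2 * v0' - v0 * v2'))
     (a * u2' + b' * u2 - (v0 * v1' - v1 * v0'))
     (a' * v0 + b * v0' + (u1 * u2' - u2 * u1'))
     (a' * v1 + b * v1' + (u2 * u0' - u0 * u2'))
     (a' * v2 + b * v2' + (u0 * u1' - u1 * u0'))
     (b * b' + (v0 * u0' + v1 * u1' + v2 * u2')) :> 'rV[F]_8.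
Proof.
have Ea (c d : F) u v : zorn_a (mk_zorn c u v d) = c.
  by rewrite /zorn_a !row_mxKl mxE eqxx.
have Eu (c d : F) u v : zorn_u (mk_zorn c u v d) = u.
  by rewrite /zorn_u row_mxKl row_mxKr.
have Ev (c d : F) u v : zorn_v (mk_zorn c u v d) = v.
  by rewrite /zorn_v row_mxKr row_mxKl.
have Eb (c d : F) u v : zorn_b (mk_zorn c u v d) = d.
  by rewrite /zorn_b !row_mxKr mxE eqxx.
rewrite !zvE /zorn_mul !Ea !Eu !Ev !Eb /dotv.
congr mk_zorn; first by rewrite !big_ord_recl !big_ord0 !mxE /= !addr0 !addrA.
- by apply: row3P; rewrite !mxE.
- by apply: row3P; rewrite !mxE.
by rewrite !big_ord_recl !big_ord0 !mxE /= !addr0 !addrA.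
Qed.

(* Let e1, e2, e3 and f1, f2, f3 be the bases of the two F^3 components. A
   product-preserving map fixing e1, with f3 |-> f3 + al e1,
   f2 |-> f2 + be f3 + ga e1 and coefficients c, d2, d3 of f1's image at the
   first idempotent, f2 and f3, is determined by these data, as f1, f2, f3
   generate the algebra. *)
Definition umx (al be ga c d2 d3 : F) : 'M[F]_8 := \matrix_(i < 8)
  nth 0 [::
    zv 1 (- c) 0 0 0 al (al * be - ga) 0;
    zv 0 1 0 0 0 0 0 0;
    zv (- al) (al * c - d2) 1 0 0 (- al ^+ 2) (al * ga - c - al ^+ 2 * be) al;
    zv ga (be * d2 - d3 - c * ga) (- be) 1 0 (c + al * ga)
       (be * c - ga ^+ 2 + al * be * ga) (- ga);
    zv c (al * d3 - c ^+ 2 + d2 * ga - al * be * d2) (al * be - ga) (- al)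
       1 d2 d3 (- c);
    zv 0 ga 0 0 0 1 be 0;
    zv 0 al 0 0 0 0 1 0;
    zv 0 c 0 0 0 (- al) (ga - al * be) 1] i.

Lemma zv_umx a u0 u1 u2 v0 v1 v2 b al be ga c d2 d3 :
  zv a u0 u1 u2 v0 v1 v2 b *m umx al be ga c d2 d3 =
  zv (a - al * u1 + ga * u2 + c * v0)
     (- c * a + u0 + (al * c - d2) * u1 + (be * d2 - d3 - c * ga) * u2
      + (al * d3 - c ^+ 2 + d2 * ga - al * be * d2) * v0
      + ga * v1 + al * v2 + c * b)
     (u1 - be * u2 + (al * be - ga) * v0)
     (u2 - al * v0)
     v0
     (al * a - al ^+ 2 * u1 + (c + al * ga) * u2 + d2 * v0 + v1 - al * b)
     ((al * be - ga) * a + (al * ga - c - al ^+ 2 * be) * u1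
      + (be * c - ga ^+ 2 + al * be * ga) * u2
      + d3 * v0 + be * v1 + v2 + (ga - al * be) * b)
     (al * u1 - ga * u2 - c * v0 + b).
Proof.
rewrite mulmx_sum_row !big_ord_recl big_ord0 !rowK !mxE /= !zvZ addr0 !zvD.
by congr zv; ring.
Qed.

Lemma umx_mul al be ga c d2 d3 al' be' ga' c' d2' d3' :
  umx al be ga c d2 d3 *m umx al' be' ga' c' d2' d3' =
  umx (al + al') (be + be') (ga + ga' + al' * be)
    (c + c' + al' * ga - al * ga' - al * al' * be)
    (d2 + d2' + al' * c *+ 2 - al * c' + al' ^+ 2 * ga - al * al' * ga'
     - al * al' ^+ 2 * be)
    (d3 + d3' + be' * d2 + c' * ga - ga' * c *+ 2 + al' * be' * c *+ 2
     - al' * ga * ga' - al * be' * c' - al * be * c' + al * ga' ^+ 2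
     + al' ^+ 2 * be' * ga - al * al' * be' * ga' + al * al' * be * ga'
     - al * al' ^+ 2 * be * be').
Proof.
apply/row_matrixP=> i; rewrite row_mul !rowK.
by case: i => -[|[|[|[|[|[|[|[|[]]]]]]]]] //= _; rewrite zv_umx; congr zv; ring.
Qed.

Lemma umx_zorn_mul al be ga c d2 d3 (x y : 'rV[F]_8) :
  zorn_mul (x *m umx al be ga c d2 d3) (y *m umx al be ga c d2 d3) =
  zorn_mul x y *m umx al be ga c d2 d3.
Proof.
have [a [u0 [u1 [u2 [v0 [v1 [v2 [b ->]]]]]]]] := zvP x.
have [a' [u0' [u1' [u2' [v0' [v1' [v2' [b' ->]]]]]]]] := zvP y.
by rewrite zorn_mulE !zv_umx zorn_mulE; congr zv; ring.
Qed.

Lemma umx0 : umx 0 0 0 0 0 0 = 1%:M.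
Proof.
apply/row_matrixP=> i; rewrite rowK row1.
apply/rowP=> j; rewrite !mxE.
by case: i => -[|[|[|[|[|[|[|[|[]]]]]]]]] //= ?;
  case: j => -[|[|[|[|[|[|[|[|[]]]]]]]]] //= ?; rewrite !mxE /=; ring.
Qed.

(** The image of f1 has eight unknown coordinates. The relation (e1 f1) e1 = e1 gives one of them,
    f1 f1 = 0 gives two, and the anticommutation of f1 with f2 and with f3 gives one each. The
    remaining three are c, d2 and d3. *)
Lemma umx_eq (g : 'M[F]_8) al be ga :
  (forall x y : 'rV[F]_8, zorn_mul (x *m g) (y *m g) = zorn_mul x y *m g) ->
  zv 0 1 0 0 0 0 0 0 *m g = zv 0 1 0 0 0 0 0 0 ->
  zv 0 0 0 0 0 0 1 0 *m g = zv 0 al 0 0 0 0 1 0 ->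
  zv 0 0 0 0 0 1 0 0 *m g = zv 0 ga 0 0 0 1 be 0 ->
  exists c d2 d3, g = umx al be ga c d2 d3.
Proof.
move=> gM ge1 gf3 gf2.
have [c [c1 [c2 [c3 [k [d2 [d3 [b gf1]]]]]]]] := zvP (zv 0 0 0 0 1 0 0 0 *m g).
have k1 : k = 1.
  have := gM (zorn_mul (zv 0 1 0 0 0 0 0 0) (zv 0 0 0 0 1 0 0 0)) (zv 0 1 0 0 0
    0 0 0); rewrite -[in LHS]gM ge1 gf1 !zorn_mulE.
  rewrite [X in _ = X *m g](_ : _ = zv 0 1 0 0 0 0 0 0); last by congr zv; ring.
  by rewrite ge1 => /zv_inj[[_ K _ _] _ _ _ _]; rewrite -[RHS]K; ring.
subst k.
have : zorn_mul ((zv 0 0 0 0 1 0 0 0) *m g) ((zv 0 0 0 0 1 0 0 0) *m g) = 0 *m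
  g.
  rewrite gM; congr (_ *m _); rewrite zorn_mulE.
  by apply/rowP=> j; rewrite !mxE;
    case: j => -[|[|[|[|[|[|[|[|[]]]]]]]]] //= _; ring.
rewrite mul0mx (_ : 0 = zv 0 0 0 0 0 0 0 0); last first.
  by apply/rowP=> j; rewrite !mxE; case: j => -[|[|[|[|[|[|[|[|[]]]]]]]]].
rewrite gf1 zorn_mulE => /zv_inj[[N1 _ _ _] V0 _ _ _].
have {V0} b1 : b = - c by apply/eqP; rewrite -addr_eq0 -[X in _ == X]V0;
  apply/eqP; ring.
subst b.
have anti x y : zorn_mul x y + zorn_mul y x = 0 ->
    zorn_mul (x *m g) (y *m g) + zorn_mul (y *m g) (x *m g) = zv 0 0 0 0 0 0 0
      0.
  move=> E; rewrite !gM -mulmxDl E mul0mx.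
  by apply/rowP=> j; rewrite !mxE; case: j => -[|[|[|[|[|[|[|[|[]]]]]]]]].
have /anti : zorn_mul (zv 0 0 0 0 1 0 0 0) (zv 0 0 0 0 0 1 0 0) + zorn_mul (zv
  0 0 0 0 0 1 0 0) (zv 0 0 0 0 1 0 0 0) = 0.
  rewrite !zorn_mulE zvD.
  by apply/rowP=> j; rewrite !mxE;
    case: j => -[|[|[|[|[|[|[|[|[]]]]]]]]] //= _; ring.
rewrite gf1 gf2 !zorn_mulE zvD => /zv_inj[[E2 _ _ _] _ _ _ _].
have /anti : zorn_mul (zv 0 0 0 0 1 0 0 0) (zv 0 0 0 0 0 0 1 0) + zorn_mul (zv
  0 0 0 0 0 0 1 0) (zv 0 0 0 0 1 0 0 0) = 0.
  rewrite !zorn_mulE zvD.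
  by apply/rowP=> j; rewrite !mxE;
    case: j => -[|[|[|[|[|[|[|[|[]]]]]]]]] //= _; ring.
rewrite gf1 gf3 !zorn_mulE zvD => /zv_inj[[E3 _ _ _] _ _ _ _].
have {E3} c3E : c3 = - al.
  by apply/eqP; rewrite -addr_eq0 -[X in _ == X]E3; apply/eqP; ring.
subst c3.
have {E2} c2E : c2 = al * be - ga.
  by apply/eqP; rewrite -subr_eq0 -[X in _ == X]E2; apply/eqP; ring.
subst c2.
have {N1} c1E : c1 = al * d3 - c ^+ 2 + d2 * ga - al * be * d2.
  by apply/eqP; rewrite -subr_eq0 -[X in _ == X]N1; apply/eqP; ring.
subst c1.
exists c, d2, d3; apply/row_matrixP=> i; rewrite rowK.
have -> : row i g = zv (i == 0 :> nat)%:R (i == 1%N :> nat)%:R (i == 2%N :>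
  nat)%:R (i == 3%N :> nat)%:R
   (i == 4%N :> nat)%:R (i == 5%N :> nat)%:R (i == 6%N :> nat)%:R (i == 7%N :>
     nat)%:R *m g.
  rewrite rowE; congr (_ *m _); apply/rowP=> j;
    rewrite !mxE eqxx andTb -val_eqE /= eq_sym.
  by case: j => -[|[|[|[|[|[|[|[|[]]]]]]]]].
(* The basis vectors other than e1, f1, f2, f3 are the products e1 f1, f1 f3, f2 f1 and f1 e1. *)
case: i => -[|[|[|[|[|[|[|[|[]]]]]]]]] //= _.
- have -> : zv 1 0 0 0 0 0 0 0 = zorn_mul (zv 0 1 0 0 0 0 0 0) (zv 0 0 0 0 1 0
  0 0) by rewrite zorn_mulE; congr zv; ring.
  by rewrite -gM ge1 gf1 zorn_mulE; congr zv; ring.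
- have -> : zv 0 0 1 0 0 0 0 0 = zorn_mul (zv 0 0 0 0 1 0 0 0) (zv 0 0 0 0 0 0
  1 0) by rewrite zorn_mulE; congr zv; ring.
  by rewrite -gM gf1 gf3 zorn_mulE; congr zv; ring.
- have -> : zv 0 0 0 1 0 0 0 0 = zorn_mul (zv 0 0 0 0 0 1 0 0) (zv 0 0 0 0 1 0
  0 0) by rewrite zorn_mulE; congr zv; ring.
  by rewrite -gM gf1 gf2 zorn_mulE; congr zv; ring.
- have -> : zv 0 0 0 0 0 0 0 1 = zorn_mul (zv 0 0 0 0 1 0 0 0) (zv 0 1 0 0 0 0
  0 0) by rewrite zorn_mulE; congr zv; ring.
by rewrite -gM gf1 ge1 zorn_mulE; congr zv; ring.
Qed.

(** The shape is that of the coordinate [z] of the unipotent group, in which the parameter d3 occurs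
    doubled. *)
Lemma double_subI (a b c x y : F) : 2 != 0 :> F ->
  a - (x - b + c) *+ 2 = a - (y - b + c) *+ 2 -> x = y.
Proof.
move=> nz2 /eqP; rewrite -subr_eq0 => /eqP E.
have /eqP : (y - x) * 2 = 0 by rewrite -[RHS]E; ring.
by rewrite mulf_eq0 (negPf nz2) orbF subr_eq0 => /eqP.
Qed.

Lemma half_solve (x w h : F) : h * 2 = 1 -> x - (x - w) * h *+ 2 = w.
Proof. by move=> h2; rewrite -mulr_natr -mulrA h2; ring. Qed.

(** The entries of the two differences outside e1 and f3 give linear equations that leave y in the
    span of e1, f2, f3 and the identity octonion. Every automorphism fixes the identity, so only
    [zorn_mul y y = 0] excludes a multiple of it. *)
Lemma umx_flag (y : 'rV[F]_8) x r x' r' :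
    y *m umx 1 0 0 0 0 0 - y = zv 0 x 0 0 0 0 r 0 ->
    y *m umx 0 1 0 0 0 0 - y = zv 0 x' 0 0 0 0 r' 0 -> zorn_mul y y = 0 ->
  exists u0, y = zv 0 u0 0 0 0 r' x 0.
Proof.
have [a [u0 [u1 [u2 [v0 [v1 [v2 [b ->]]]]]]]] := zvP y.
move=> /(congr1 (+%R^~ (zv a u0 u1 u2 v0 v1 v2 b))); rewrite subrK zv_umx zvD.
move=> /zv_inj[[_ A2 _ A4] _ A6 _ A8].
move=> /(congr1 (+%R^~ (zv a u0 u1 u2 v0 v1 v2 b))); rewrite subrK zv_umx zvD.
move=> /zv_inj[[_ _ B3 _] _ _ B7 _].
have u1E : u1 = 0 by rewrite -(subrr b) -[X in X - b](etrans A8 (add0r b));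
  ring.
have v0E : v0 = 0 by rewrite -(subrr u2) -[X in _ - X](etrans A4 (add0r u2));
  ring.
have u2E : u2 = 0 by rewrite -(subrr u1) -[X in _ - X](etrans B3 (add0r u1));
  ring.
have abE : a = b.
  rewrite -(addrK v1 b) -[X in b + X - v1](etrans A6 (add0r v1)) u1E; ring.
move: A2 B7; rewrite u1E v0E u2E abE => A2 B7.
have v2E : v2 = x by rewrite -(addrK u0 x) -A2; ring.
have v1E : v1 = r' by rewrite -(addrK v2 r') -B7; ring.
rewrite v1E v2E zorn_mulE => /rowP/(_ (inord 0)); rewrite !mxE inordK //=.
rewrite !mul0r mulr0 !addr0 => /eqP; rewrite mulf_eq0 orbb => /eqP ->.
by exists u0.
Qed.

(** On the flag g is triangular with diagonal l, m, k, and these are raised to the power N. The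
    off-diagonal entries of the powers need no formula, hence the existential c' and r' in the
    induction. *)
Lemma flag_expmx (g : 'M[F]_8) l x m y k w N :
    zv 0 1 0 0 0 0 0 0 *m g = zv 0 l 0 0 0 0 0 0 ->
    zv 0 0 0 0 0 0 1 0 *m g = zv 0 x 0 0 0 0 m 0 ->
    zv 0 0 0 0 0 1 0 0 *m g = zv 0 y 0 0 0 k w 0 ->
    g ^+ N = 1%:M -> [/\ l ^+ N = 1, m ^+ N = 1 & k ^+ N = 1].
Proof.
move=> E1 E3 E2 gN.
have act c s r : zv 0 c 0 0 0 s r 0 *m g =
    zv 0 (c * l + s * y + r * x) 0 0 0 (s * k) (s * w + r * m) 0.
  rewrite (_ : zv _ _ _ _ _ _ _ _ = c *: zv 0 1 0 0 0 0 0 0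
    + s *: zv 0 0 0 0 0 1 0 0 + r *: zv 0 0 0 0 0 0 1 0); last first.
    by rewrite !zvZ !zvD; congr zv; ring.
  by rewrite !mulmxDl -!scalemxAl E1 E2 E3 !zvZ !zvD; congr zv; ring.
have iter c s r : exists c' r', [/\
    zv 0 c 0 0 0 s r 0 *m g ^+ N = zv 0 c' 0 0 0 (s * k ^+ N) r' 0,
    s = 0 -> r' = r * m ^+ N & s = 0 -> r = 0 -> c' = c * l ^+ N].
  elim: N {gN} => [|N [c' [r' [E Er Ec]]]].
    by exists c, r; rewrite !expr0 mulmx1 !mulr1.
  exists (c' * l + s * k ^+ N * y + r' * x), (s * k ^+ N * w + r' * m).
  rewrite !exprSr mulmxA E act; split; first by congr zv; ring.
    by move=> s0; rewrite Er // s0; ring.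
  by move=> s0 r0; rewrite Ec // Er // s0 r0; ring.
rewrite gN in iter; split.
- have [c' [r' [+ _ /(_ erefl erefl) E]]] := iter 1 0 0.
  by rewrite mulmx1 E mul1r => /zv_inj[[_ <- _ _] _ _ _ _].
- have [c' [r' [+ /(_ erefl) E _]]] := iter 0 0 1.
  by rewrite mulmx1 E mul1r => /zv_inj[_ _ _ <- _].
have [c' [r' [+ _ _]]] := iter 0 1 0.
by rewrite mulmx1 mul1r => /zv_inj[_ _ <- _ _].
Qed.

End ZornCoordinates.

(** * The group of order p^6 *)

(* Coordinates identifying S with the semidirect product of F_p, acting on
   binary cubics w by substitution, with the Heisenberg group of the
   invariant symplectic form
     omega w w' = w0 w3' - 3 w1 w2' + 3 w2 w1' - w3 w0'. *)
Record G2_coords (p : nat) (gT : finGroupType) (S : {group gT}) := G2Coords {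
  ct : gT -> 'F_p;
  cw0 : gT -> 'F_p;
  cw1 : gT -> 'F_p;
  cw2 : gT -> 'F_p;
  cw3 : gT -> 'F_p;
  cz : gT -> 'F_p;
  ctM : {in S &, forall x y, ct (x * y) = (ct x + ct y)%R};
  cw0M : {in S &, forall x y, cw0 (x * y) = (cw0 x + cw0 y)%R};
  cw1M : {in S &, forall x y,
    cw1 (x * y) = (cw1 x + ct y * cw0 x + cw1 y)%R};
  cw2M : {in S &, forall x y, cw2 (x * y) =
    (cw2 x + ct y * cw1 x *+ 2 + ct y ^+ 2 * cw0 x + cw2 y)%R};
  cw3M : {in S &, forall x y, cw3 (x * y) =
    (cw3 x + ct y * cw2 x *+ 3 + ct y ^+ 2 * cw1 x *+ 3
     + ct y ^+ 3 * cw0 x + cw3 y)%R};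
  czM : {in S &, forall x y, cz (x * y) =
    (cz x + cz y + cw0 x * cw3 y - (cw1 x + ct y * cw0 x) * cw2 y *+ 3
     + (cw2 x + ct y * cw1 x *+ 2 + ct y ^+ 2 * cw0 x) * cw1 y *+ 3
     - (cw3 x + ct y * cw2 x *+ 3 + ct y ^+ 2 * cw1 x *+ 3
        + ct y ^+ 3 * cw0 x) * cw0 y)%R};
  coords_inj : {in S &, forall x y, ct x = ct y -> cw0 x = cw0 y ->
    cw1 x = cw1 y -> cw2 x = cw2 y -> cw3 x = cw3 y -> cz x = cz y -> x = y};
  coords_surj : forall t w0 w1 w2 w3 z, exists2 x, x \in S &
    [/\ [/\ ct x = t, cw0 x = w0 & cw1 x = w1], cw2 x = w2, cw3 x = w3
       & cz x = z]
}.

Lemma Fp_natr_neq0 p n : prime p -> (0 < n < p)%N -> (n%:R != 0 :> 'F_p)%R.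
Proof.
move=> p_pr /andP[n_gt0 lt_np].
by rewrite -(dvdn_pcharf (pchar_Fp p_pr)) gtnNdvd.
Qed.

Lemma card_coord (gT : finGroupType) (T : finType) (A : {set gT}) (f : gT -> T)
  :
  {in A &, injective f} -> (forall y, exists2 x, x \in A & f x = y) ->
  #|A| = #|T|.
Proof.
move=> injf surjf; rewrite -(card_in_imset injf) -cardsT;
  congr #|pred_of_set _|.
by apply/setP=> y; rewrite inE; apply/imsetP; have [x Ax <-] := surjf y;
  exists x.
Qed.

Section Coordinates.

Variables (p : nat) (gT : finGroupType) (S : {group gT}) (C : G2_coords p S).
Hypotheses (p_pr : prime p) (p_ge5 : (5 <= p)%N).
Local Notation t := (ct C).
Local Notation w0 := (cw0 C).
Local Notation w1 := (cw1 C).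
Local Notation w2 := (cw2 C).
Local Notation w3 := (cw3 C).
Local Notation z := (cz C).
Implicit Types (x y g : gT) (K L H M N P R A : {group gT}).

Let two_neq0 : (2%:R != 0 :> 'F_p)%R.
Proof. by apply: Fp_natr_neq0; rewrite //= (leq_trans _ p_ge5). Qed.
Let three_neq0 : (3%:R != 0 :> 'F_p)%R.
Proof. by apply: Fp_natr_neq0; rewrite //= (leq_trans _ p_ge5). Qed.

Lemma coord_eq x y : x \in S -> y \in S -> t x = t y -> w0 x = w0 y ->
  w1 x = w1 y -> w2 x = w2 y -> w3 x = w3 y -> z x = z y -> x = y.
Proof. exact: coords_inj. Qed.

Lemma coord_t1 : t 1 = 0%R.
Proof. by apply: (addrI (t 1)); rewrite -ctM // mul1g addr0. Qed.
Lemma coord_w01 : w0 1 = 0%R.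
Proof. by apply: (addrI (w0 1)); rewrite -cw0M // mul1g addr0. Qed.
Lemma coord_w11 : w1 1 = 0%R.
Proof.
apply: (addrI (w1 1)); rewrite addr0 -[in RHS](mulg1 1) cw1M // coord_t1.
ring.
Qed.
Lemma coord_w21 : w2 1 = 0%R.
Proof.
apply: (addrI (w2 1)); rewrite addr0 -[in RHS](mulg1 1) cw2M // coord_t1.
ring.
Qed.
Lemma coord_w31 : w3 1 = 0%R.
Proof.
apply: (addrI (w3 1)); rewrite addr0 -[in RHS](mulg1 1) cw3M // coord_t1.
ring.
Qed.
Lemma coord_z1 : z 1 = 0%R.
Proof.
apply: (addrI (z 1)); rewrite addr0 -[in RHS](mulg1 1) czM // coord_t1.
rewrite coord_w01 coord_w11; ring.
Qed.

(** * The subgroups Q1 and Q2 and a central chain *)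

Definition subQ1 := [set x in S | w0 x == 0%R].
Definition subQ2 := [set x in S | t x == 0%R].
(** [subZ4] is the intersection of [subQ1] and [subQ2]. The groups [subZ1] to [subZ4] have orders p
    to p^4, and commutators with elements of S take each of them into the preceding one. *)
Definition subZ4 := [set x in subQ2 | w0 x == 0%R].
Definition subZ3 := [set x in subZ4 | w1 x == 0%R].
Definition subZ2 := [set x in subZ3 | w2 x == 0%R].
Definition subZ1 := [set x in subZ2 | w3 x == 0%R].

Lemma subQ1_group_set : group_set subQ1.
Proof.
apply/group_setP; split=> [|x y]; first by rewrite inE group1 coord_w01 eqxx.
move=> /setIdP[Sx /eqP x0] /setIdP[Sy /eqP y0].
by rewrite inE groupM // cw0M // x0 y0 addr0 eqxx.
Qed.
Canonical subQ1_group := Group subQ1_group_set.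

Lemma subQ2_group_set : group_set subQ2.
Proof.
apply/group_setP; split=> [|x y]; first by rewrite inE group1 coord_t1 eqxx.
move=> /setIdP[Sx /eqP x0] /setIdP[Sy /eqP y0].
by rewrite inE groupM // ctM // x0 y0 addr0 eqxx.
Qed.
Canonical subQ2_group := Group subQ2_group_set.

Lemma subQ2_coord x : x \in subQ2 -> x \in S /\ t x = 0%R.
Proof. by case/setIdP=> Sx /eqP. Qed.

Lemma subZ4_coord x : x \in subZ4 -> [/\ x \in S, t x = 0 & w0 x = 0]%R.
Proof. by case/setIdP=> /subQ2_coord[Sx ->] /eqP. Qed.

Lemma subZ4_group_set : group_set subZ4.
Proof.
apply/group_setP; split=> [|x y]; first by rewrite inE group1 coord_w01 eqxx.
move=> /setIdP[Qx /eqP x0] /setIdP[Qy /eqP y0].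
have [[Sx _] [Sy _]] := (subQ2_coord Qx, subQ2_coord Qy).
by rewrite inE groupM // cw0M // x0 y0 addr0 eqxx.
Qed.
Canonical subZ4_group := Group subZ4_group_set.

Lemma subZ3_coord x : x \in subZ3 -> [/\ x \in S, t x = 0,
  w0 x = 0 & w1 x = 0]%R.
Proof. by case/setIdP=> /subZ4_coord[Sx -> ->] /eqP. Qed.

Lemma subZ3_group_set : group_set subZ3.
Proof.
apply/group_setP; split=> [|x y]; first by rewrite inE group1 coord_w11 eqxx.
move=> /setIdP[Qx /eqP x0] /setIdP[Qy /eqP y0].
have [[Sx tx xw0] [Sy ty yw0]] := (subZ4_coord Qx, subZ4_coord Qy).
by rewrite inE groupM // cw1M // x0 y0 xw0 mulr0 !addr0 eqxx.
Qed.
Canonical subZ3_group := Group subZ3_group_set.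

Lemma subZ2_coord x : x \in subZ2 ->
  [/\ x \in S, t x = 0, w0 x = 0, w1 x = 0 & w2 x = 0]%R.
Proof. by case/setIdP=> /subZ3_coord[Sx -> -> ->] /eqP. Qed.

Lemma subZ2_group_set : group_set subZ2.
Proof.
apply/group_setP; split=> [|x y]; first by rewrite inE group1 coord_w21 eqxx.
move=> /setIdP[Qx /eqP x0] /setIdP[Qy /eqP y0].
have [[Sx tx xw0 xw1] [Sy ty yw0 yw1]] := (subZ3_coord Qx, subZ3_coord Qy).
by rewrite inE groupM // cw2M // x0 y0 xw0 xw1 !(mulr0, mul0rn, addr0) eqxx.
Qed.
Canonical subZ2_group := Group subZ2_group_set.

Lemma subZ1_coord x : x \in subZ1 ->
  [/\ x \in S, t x = 0, w0 x = 0, w1 x = 0 & w2 x = 0 /\ w3 x = 0]%R.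
Proof. by case/setIdP=> /subZ2_coord[Sx -> -> -> ->] /eqP. Qed.

Lemma subZ1_group_set : group_set subZ1.
Proof.
apply/group_setP; split=> [|x y]; first by rewrite inE group1 coord_w31 eqxx.
move=> /setIdP[Qx /eqP x0] /setIdP[Qy /eqP y0].
have [[Sx tx xw0 xw1 xw2] [Sy ty yw0 yw1 _]] :=
  (subZ2_coord Qx, subZ2_coord Qy).
by rewrite inE groupM // cw3M // x0 y0 xw0 xw1 xw2 !(mulr0, mul0rn, addr0) eqxx.
Qed.
Canonical subZ1_group := Group subZ1_group_set.

Let cardF : #|'F_p| = p. Proof. exact: card_Fp. Qed.

Lemma card_S : #|S| = (p ^ 6)%N.
Proof.
rewrite (@card_coord _ _ _ (fun x => (t x, w0 x, w1 x, w2 x, w3 x, z x))).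
- by rewrite !card_prod !cardF !expnS expn0 muln1 !mulnA.
- by move=> x y Sx Sy [*]; apply: coord_eq.
move=> [[[[[a b] c] d] e] f];
  have [x Sx [[<- <- <-] <- <- <-]] := coords_surj C a b c d e f.
by exists x.
Qed.

Lemma card_Q2 : #|subQ2| = (p ^ 5)%N.
Proof.
rewrite (@card_coord _ _ _ (fun x => (w0 x, w1 x, w2 x, w3 x, z x))).
- by rewrite !card_prod !cardF !expnS expn0 muln1 !mulnA.
- by move=> x y /subQ2_coord[Sx tx] /subQ2_coord[Sy ty] [*]; apply: coord_eq;
  rewrite ?tx.
move=> [[[[b c] d] e] f]; have [x Sx [[xt <- <-] <- <- <-]] :=
  coords_surj C 0%R b c d e f.
by exists x; rewrite // inE Sx xt /=.
Qed.

Lemma card_Q1 : #|subQ1| = (p ^ 5)%N.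
Proof.
rewrite (@card_coord _ _ _ (fun x => (t x, w1 x, w2 x, w3 x, z x))).
- by rewrite !card_prod !cardF !expnS expn0 muln1 !mulnA.
- by move=> x y /setIdP[Sx /eqP x0] /setIdP[Sy /eqP y0] [*]; apply: coord_eq;
  rewrite ?x0.
move=> [[[[b c] d] e] f]; have [x Sx [[<- xt <-] <- <- <-]] :=
  coords_surj C b 0%R c d e f.
by exists x; rewrite // inE Sx xt /=.
Qed.

Lemma card_Z4 : #|subZ4| = (p ^ 4)%N.
Proof.
rewrite (@card_coord _ _ _ (fun x => (w1 x, w2 x, w3 x, z x))).
- by rewrite !card_prod !cardF !expnS expn0 muln1 !mulnA.
- by move=> x y /subZ4_coord[Sx tx x0] /subZ4_coord[Sy ty y0] [*];
  apply: coord_eq; rewrite ?tx ?x0.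
move=> [[[c d] e] f]; have [x Sx [[xt x0 <-] <- <- <-]] :=
  coords_surj C 0%R 0%R c d e f.
by exists x; rewrite // !inE Sx xt x0 !eqxx.
Qed.

Lemma card_Z3 : #|subZ3| = (p ^ 3)%N.
Proof.
rewrite (@card_coord _ _ _ (fun x => (w2 x, w3 x, z x))).
- by rewrite !card_prod !cardF !expnS expn0 muln1 !mulnA.
- by move=> x y /subZ3_coord[Sx tx x0 x1] /subZ3_coord[Sy ty y0 y1] [*];
  apply: coord_eq; rewrite ?tx ?x0 ?x1.
move=> [[d e] f]; have [x Sx [[xt x0 x1] <- <- <-]] :=
  coords_surj C 0%R 0%R 0%R d e f.
by exists x; rewrite // !inE Sx xt x0 x1 !eqxx.
Qed.

Lemma card_Z2 : #|subZ2| = (p ^ 2)%N.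
Proof.
rewrite (@card_coord _ _ _ (fun x => (w3 x, z x))).
- by rewrite !card_prod !cardF !expnS expn0 muln1.
- by move=> x y /subZ2_coord[Sx tx x0 x1 x2] /subZ2_coord[Sy ty y0 y1 y2] [*];
  apply: coord_eq; rewrite ?tx ?x0 ?x1 ?x2.
move=> [e f]; have [x Sx [[xt x0 x1] x2 <- <-]] :=
  coords_surj C 0%R 0%R 0%R 0%R e f.
by exists x; rewrite // !inE Sx xt x0 x1 x2 !eqxx.
Qed.

Lemma card_Z1 : #|subZ1| = p.
Proof.
rewrite (@card_coord _ _ _ z) //.
- by move=> x y /subZ1_coord[Sx tx x0 x1 [x2 x3]] /subZ1_coord[Sy ty y0 y1 [y2
  y3]] *; apply: coord_eq; rewrite ?tx ?x0 ?x1 ?x2 ?x3.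
move=> f; have [x Sx [[xt x0 x1] x2 x3 <-]] :=
  coords_surj C 0%R 0%R 0%R 0%R 0%R f.
by exists x; rewrite // !inE Sx xt x0 x1 x2 x3 !eqxx.
Qed.
Lemma subQ1S : subQ1 \subset S. Proof. by apply/subsetP=> x /setIdP[]. Qed.
Lemma subQ2S : subQ2 \subset S. Proof. by apply/subsetP=> x /setIdP[]. Qed.
Lemma subZ4Q2 : subZ4 \subset subQ2. Proof. by apply/subsetP=> x /setIdP[]. Qed.
Lemma subZ34 : subZ3 \subset subZ4. Proof. by apply/subsetP=> x /setIdP[]. Qed.
Lemma subZ23 : subZ2 \subset subZ3. Proof. by apply/subsetP=> x /setIdP[]. Qed.
Lemma subZ12 : subZ1 \subset subZ2. Proof. by apply/subsetP=> x /setIdP[]. Qed.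
Lemma subZ2Q2 : subZ2 \subset subQ2.
Proof. exact: subset_trans subZ23 (subset_trans subZ34 subZ4Q2). Qed.
Lemma subZ2Q1 : subZ2 \subset subQ1.
Proof. by apply/subsetP=> x /subZ2_coord[Sx _ x0 _ _];
  rewrite inE Sx x0 eqxx. Qed.
Lemma subZ2S : subZ2 \subset S. Proof. exact: subset_trans subZ2Q2 subQ2S. Qed.

Lemma S_pgroup : p.-group S.
Proof. by rewrite /pgroup card_S pnatX pnat_id. Qed.

Lemma sub_pgroup K : K \subset S -> p.-group K.
Proof. by move=> sKS; apply: pgroupS sKS S_pgroup. Qed.

(** A has index p in B, so it is maximal there, while [K :&: B] contains A and also k. This is how a
    subgroup K climbs the chain. *)
Lemma mem_sub_prime_step (A B K : {group gT}) k : #|B| = (p * #|A|)%N ->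
  A \subset B -> A \subset K -> k \in K -> k \in B -> k \notin A -> B \subset K.
Proof.
move=> cB sAB sAK Kk Bk nAk.
have /maxgroupP[_ maxA] : maximal A B.
  by apply: p_index_maximal; rewrite // -divgS // cB mulnK.
apply: contraR nAk => nBK.
have pI : (K :&: B)%G \proper B.
  rewrite properE subsetIr; apply: contra nBK => sBI.
  exact: subset_trans sBI (subsetIl _ _).
have /= <- : (K :&: B)%G :=: A by apply: maxA; rewrite // subsetI sAK.
by rewrite inE Kk.
Qed.

(** * Elements outside Q1 and Q2, and centralizers of elements *)

Lemma leq_card_Q2 K : K \subset S -> (#|K| <= p * #|K :&: subQ2|)%N.
Proof.
move=> sKS; have := mul_cardG K subQ2_group.
have : (#|(K * subQ2)%g| <= p * p ^ 5)%N.
  by rewrite -expnS -card_S subset_leq_card // mul_subG // subQ2S.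
rewrite /= card_Q2 => le_KQ E.
by rewrite -(@leq_pmul2r (p ^ 5)) ?expn_gt0 ?(prime_gt0 p_pr) // E mulnAC
  leq_mul2r le_KQ orbT.
Qed.

Lemma leq_card_Q1 K : K \subset S -> (#|K| <= p * #|K :&: subQ1|)%N.
Proof.
move=> sKS; have := mul_cardG K subQ1_group.
have : (#|(K * subQ1)%g| <= p * p ^ 5)%N.
  by rewrite -expnS -card_S subset_leq_card // mul_subG // subQ1S.
rewrite /= card_Q1 => le_KQ E.
by rewrite -(@leq_pmul2r (p ^ 5)) ?expn_gt0 ?(prime_gt0 p_pr) // E mulnAC
  leq_mul2r le_KQ orbT.
Qed.

(** The elements of S outside both [subQ1] and [subQ2]. In a Sylow subgroup of G2(p) these are the
    regular unipotent elements, with both simple root coordinates nonzero. *)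
Definition good g := [&& g \in S, t g != 0%R & w0 g != 0%R].

Lemma exists_good K : K \subset S -> ~~ (K \subset subQ1) ->
  ~~ (K \subset subQ2) -> exists2 g, g \in K & good g.
Proof.
move=> sKS /subsetPn[x Kx] + /subsetPn[y Ky].
have [Sx Sy] := (subsetP sKS x Kx, subsetP sKS y Ky).
rewrite !inE Sx Sy /= => x0 yt.
have [xt|xt] := eqVneq (t x) 0%R; last by exists x; rewrite /good ?Sx ?xt.
have [y0|y0] := eqVneq (w0 y) 0%R; last by exists y; rewrite /good ?Sy ?y0 ?yt.
exists (x * y); first exact: groupM.
by rewrite /good groupM // ctM // cw0M // xt y0 add0r addr0 yt.
Qed.

Lemma good_notin g : good g -> (g \notin subQ1) && (g \notin subQ2).
Proof. by case/and3P=> Sg gt g0; rewrite !inE Sg gt g0. Qed.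

Let mulf_0 (a b : 'F_p) : a != 0%R -> (a * b = 0 -> b = 0)%R.
Proof. by move=> a0 /eqP; rewrite mulf_eq0 (negPf a0) => /eqP. Qed.

(** Comparing g y with y g coordinate by coordinate kills [w0 y], [w1 y], [w2 y], [w3 y] in turn.
    The respective factors are [t g], [2 t g], [3 t g] and [2 w0 g], all nonzero. *)
Lemma good_Q2 g y : good g -> y \in subQ2 -> commute g y -> y \in subZ1.
Proof.
move=> /and3P[Sg gt g0] /subQ2_coord[Sy ty] cgy.
have cC (f : gT -> 'F_p) : f (g * y) = f (y * g) by rewrite cgy.
have y0 : w0 y = 0%R.
  have := cC w1; rewrite !cw1M // ty => /eqP; rewrite -subr_eq0 => /eqP E.
  by apply: (mulf_0 gt); apply: oppr_inj; rewrite oppr0 -[RHS]E; ring.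
have y1 : w1 y = 0%R.
  have := cC w2; rewrite !cw2M // ty y0 => /eqP; rewrite -subr_eq0 => /eqP E.
  apply: (mulf_0 gt); apply: (mulf_0 two_neq0).
  by apply: oppr_inj; rewrite oppr0 -[RHS]E; ring.
have y2 : w2 y = 0%R.
  have := cC w3; rewrite !cw3M // ty y0 y1 => /eqP; rewrite -subr_eq0 => /eqP E.
  apply: (mulf_0 gt); apply: (mulf_0 three_neq0).
  by apply: oppr_inj; rewrite oppr0 -[RHS]E; ring.
have y3 : w3 y = 0%R.
  have := cC z; rewrite !czM // ty y0 y1 y2 => /eqP;
    rewrite -subr_eq0 => /eqP E.
  apply: (mulf_0 g0); apply: (mulf_0 two_neq0).
  by rewrite -[RHS]E; ring.
by rewrite !inE Sy ty y0 y1 y2 y3 !eqxx.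
Qed.

Lemma good_cent1 g K : K \subset S -> good g -> K \subset 'C[g] ->
  (#|K| <= p ^ 2)%N.
Proof.
move=> sKS gg cKg; apply: leq_trans (leq_card_Q2 sKS) _.
rewrite expnS leq_pmul2l ?(prime_gt0 p_pr) // expn1 -[leqRHS]card_Z1.
apply/subset_leq_card/subsetP=> y /setIP[Ky Qy].
by apply: (good_Q2 gg Qy); apply/cent1P; rewrite cent1C (subsetP cKg).
Qed.

Lemma subZ1_central x y : x \in subZ1 -> y \in S -> commute x y.
Proof.
move=> /subZ1_coord[Sx tx x0 x1 [x2 x3]] Sy.
by apply: coord_eq; rewrite ?groupM // ?(ctM, cw0M, cw1M, cw2M, cw3M, czM) //
  ?(tx, x0, x1, x2, x3); ring.
Qed.

Lemma subZ2_Q1_commute x y : x \in subZ2 -> y \in subQ1 -> commute x y.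
Proof.
move=> /subZ2_coord[Sx tx x0 x1 x2] /setIdP[Sy /eqP y0].
by apply: coord_eq; rewrite ?groupM // ?(ctM, cw0M, cw1M, cw2M, cw3M, czM) //
  ?(tx, x0, x1, x2, y0); ring.
Qed.

(** Up to sign, [x * y] and [y * x] differ in z by twice [w3 x * w0 y]. Together with
    [subZ2_Q1_commute] this identifies [subQ1] as the centralizer of [subZ2] in S. *)
Lemma subZ2_cent1 x y : x \in subZ2 -> x \notin subZ1 -> y \in S ->
  commute x y -> y \in subQ1.
Proof.
move=> Zx nZx Sy cxy; move: nZx; rewrite inE Zx => nx3.
have [Sx tx x0 x1 x2] := subZ2_coord Zx.
have := congr1 z cxy; rewrite !czM // tx x0 x1 x2 => /eqP.
rewrite -subr_eq0 => /eqP E; rewrite inE Sy; apply/eqP.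
apply: (mulf_0 nx3); apply: (mulf_0 two_neq0).
by apply: oppr_inj; rewrite oppr0 -[RHS]E; ring.
Qed.

Lemma Q2_cent1 x y : x \in subQ2 -> x \notin subQ1 -> y \in S ->
  commute x y -> y \in subQ2.
Proof.
move=> /subQ2_coord[Sx tx] + Sy cxy; rewrite !inE Sx Sy /= => nx0.
have := congr1 w1 cxy; rewrite !cw1M // tx => /eqP.
rewrite -subr_eq0 => /eqP E; apply/eqP.
by apply: (mulf_0 nx0); rewrite -[RHS]E; ring.
Qed.

(** The three equations come from the coordinates w2, w3 and z, after division by 2, 3 and 6. *)
Lemma Q1_commute x y : x \in subQ1 -> y \in subQ1 -> commute x y ->
  [/\ t x * w1 y = t y * w1 x,
      t x * w2 y + t x ^+ 2 * w1 y = t y * w2 x + t y ^+ 2 * w1 x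
    & w1 x * w2 y + t x * w1 x * w1 y = w2 x * w1 y + t y * w1 x * w1 y]%R.
Proof.
move=> /setIdP[Sx /eqP x0] /setIdP[Sy /eqP y0] cxy.
have nz k (a b : 'F_p) : (k%:R != 0 :> 'F_p -> (a - b) * k%:R = 0 -> a = b)%R.
  by move=> nzk /eqP; rewrite mulf_eq0 (negPf nzk) orbF subr_eq0 => /eqP.
have D (f : gT -> 'F_p) : (f (y * x)%g - f (x * y)%g = 0)%R by rewrite cxy
  subrr.
split.
- apply: (nz 2) => //; rewrite -[RHS](D w2) !cw2M // x0 y0; ring.
- apply: (nz 3) => //; rewrite -[RHS](D w3) !cw3M // x0 y0; ring.
apply: (nz 2) => //; apply: (nz 3) => //; rewrite -[RHS](D z) !czM // x0 y0;
  ring.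
Qed.

Lemma leq_card3 K (f1 f2 f3 : gT -> 'F_p) :
  {in K &, forall x y, f1 x = f1 y -> f2 x = f2 y -> f3 x = f3 y -> x = y} ->
  (#|K| <= p ^ 3)%N.
Proof.
move=> injf; rewrite -(card_in_imset (f := fun x => (f1 x, f2 x, f3 x))).
  apply: leq_trans (max_card _) _.
  by rewrite !card_prod !cardF !expnS expn0 muln1 mulnA.
by move=> x y Kx Ky [*]; apply: injf.
Qed.

(** Modulo [subZ2] an element of [subQ1] has coordinates t, w1, w2. If they are not all zero for y,
    the relations of [Q1_commute] leave only one of them free in an element commuting with y, next
    to w3 and z. The cases follow the first nonzero coordinate of y. *)
Lemma Q1_cent1 y K : y \in subQ1 -> y \notin subZ2 -> K \subset subQ1 ->
  K \subset 'C[y] -> (#|K| <= p ^ 3)%N.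
Proof.
move=> Qy nZy sK1 cKy.
have Kco x : x \in K -> x \in subQ1 /\ commute x y.
  move=> Kx; split; first exact: (subsetP sK1).
  by apply/cent1P; rewrite (subsetP cKy).
have [ty|ty] := eqVneq (t y) 0%R; last first.
  apply: (@leq_card3 K t w3 z) => x x' /Kco[Qx cx] /Kco[Qx' cx'] E1 E2 E3.
  have [[A1 A2 _] [B1 B2 _]] := (Q1_commute Qx Qy cx, Q1_commute Qx' Qy cx').
  have [/setIdP[Sx /eqP x0] /setIdP[Sx' /eqP x'0]] := (Qx, Qx').
  have F1 : w1 x = w1 x' by apply: (mulfI ty); rewrite -A1 -B1 E1.
  apply: coord_eq; rewrite ?x0 ?x'0 //.
  apply: (mulfI ty); apply: (addIr (t y ^+ 2 * w1 x)%R).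
  by rewrite -A2 F1 -B2 E1.
have [y1|y1] := eqVneq (w1 y) 0%R; last first.
  have x0 x : x \in subQ1 -> commute x y -> t x = 0%R.
    move=> Qx cx; have [A1 _ _] := Q1_commute Qx Qy cx.
    by apply: (mulf_0 y1); rewrite mulrC A1 ty mul0r.
  apply: (@leq_card3 K w1 w3 z) => x x' /Kco[Qx cx] /Kco[Qx' cx'] E1 E2 E3.
  have [[_ _ A3] [_ _ B3]] := (Q1_commute Qx Qy cx, Q1_commute Qx' Qy cx').
  have [/setIdP[Sx /eqP x00] /setIdP[Sx' /eqP x'0]] := (Qx, Qx').
  apply: coord_eq; rewrite ?x00 ?x'0 ?(x0 x) ?(x0 x') //.
  move: A3 B3; rewrite ty (x0 x) // (x0 x') // E1 !mul0r !addr0 => A3 B3.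
  by apply: (mulIf y1); rewrite -A3 -B3.
have y2 : w2 y != 0%R.
  apply: contra nZy => /eqP y2; have /setIdP[Sy /eqP y0] := Qy.
  by rewrite !inE Sy ty y0 y1 y2 !eqxx.
have x01 x : x \in subQ1 -> commute x y -> t x = 0%R /\ w1 x = 0%R.
  move=> Qx cx; have [_ A2 A3] := Q1_commute Qx Qy cx.
  move: A2 A3; rewrite ty y1 expr0n /= !(mulr0, mul0r, addr0) => A2 A3.
  by split; apply: (mulf_0 y2); rewrite mulrC.
apply: (@leq_card3 K w2 w3 z) => x x' /Kco[Qx cx] /Kco[Qx' cx'] E1 E2 E3.
have [/setIdP[Sx /eqP x0] /setIdP[Sx' /eqP x'0]] := (Qx, Qx').
have [[xt x1] [x't x'1]] := (x01 _ Qx cx, x01 _ Qx' cx').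
by apply: coord_eq; rewrite ?(x0, x'0, xt, x't, x1, x'1).
Qed.

(** * Commutators, and subgroups containing a good element *)

Let eq_by_sub (a b c d : 'F_p) : c = d -> (a - b = c - d -> a = b)%R.
Proof. by move=> -> E; apply/eqP; rewrite -subr_eq0 E subrr. Qed.

(** Modulo [subZ1], the commutator is the cubic of k after the substitution given by [t g], minus
    the cubic of k. *)
Lemma comm_coords k g : k \in subQ2 -> g \in S ->
  [/\ [~ k, g] \in subZ4, w1 [~ k, g] = (t g * w0 k)%R,
      w2 [~ k, g] = (t g * w1 k *+ 2 + t g ^+ 2 * w0 k)%R
    & w3 [~ k, g] = (t g * w2 k *+ 3 + t g ^+ 2 * w1 k *+ 3 + t g ^+ 3 * w0
      k)%R].
Proof.
move=> /subQ2_coord[Sk tk] Sg; set r := [~ k, g].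
have Sr : r \in S by rewrite groupR.
(* Comparing k g with g (k r) determines the coordinates of r without formulas for inverses. *)
have E (f : gT -> 'F_p) : f (g * (k * r)) = f (k * g).
  by rewrite mulgA -(commgC k g).
clearbody r.
have tr : t r = 0%R.
  by have := E t; rewrite !ctM ?groupM // tk => F; apply: (eq_by_sub F); ring.
have r0 : w0 r = 0%R.
  by have := E w0; rewrite !cw0M ?groupM // => F; apply: (eq_by_sub F); ring.
have r1 : w1 r = (t g * w0 k)%R.
  have := E w1; rewrite !(cw1M, cw0M, ctM) ?groupM // tk tr => F.
  by apply: (eq_by_sub F); ring.
have r2 : w2 r = (t g * w1 k *+ 2 + t g ^+ 2 * w0 k)%R.
  have := E w2; rewrite !(cw2M, cw1M, cw0M, ctM) ?groupM // tk tr => F.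
  by apply: (eq_by_sub F); ring.
split=> //; first by rewrite !inE Sr tr r0 !eqxx.
have := E w3; rewrite !(cw3M, cw2M, cw1M, cw0M, ctM) ?groupM // tk tr => F.
by apply: (eq_by_sub F); ring.
Qed.

Lemma comm_Z2 k g : k \in subZ2 -> g \in S ->
  [~ k, g] \in subZ1 /\ z [~ k, g] = (- (w3 k * w0 g) *+ 2)%R.
Proof.
move=> Zk Sg; have [Sk tk k0 k1 k2] := subZ2_coord Zk.
have [Z4r r1 r2 r3] := comm_coords (subsetP subZ2Q2 k Zk) Sg.
move: Z4r r1 r2 r3 (commgC k g); move: [~ k, g] => r Z4r + + + E.
have [Sr tr r0] := subZ4_coord Z4r.
rewrite k0 k1 k2 !(mulr0, mul0rn, addr0) => r1 r2 r3.
split; first by rewrite !inE Sr tr r0 r1 r2 r3 !eqxx.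
have := congr1 z E; rewrite -mulgA.
rewrite !(czM, cw3M, cw2M, cw1M, cw0M,
  ctM) ?groupM // tk k0 k1 k2 tr r0 r1 r2 r3 => F.
by apply: (eq_by_sub (esym F)); ring.
Qed.

(** The commutator of k with g falls by exactly one term of the chain, so K contains the term below
    that of k, and then by index p the term of k itself. The same argument, one term higher each
    time, gives [good_Z3], [good_Z4] and [good_sub_Q2]. *)
Lemma good_subZ1 g k K : good g -> g \in K -> k \in K -> k \in subZ2 ->
  k \notin subZ1 -> subZ2 \subset K.
Proof.
move=> /and3P[Sg gt g0] Kg Kk Z2k nZk.
have [Z1r rz] := comm_Z2 Z2k Sg.
have k3 : w3 k != 0%R by move: nZk; rewrite inE Z2k.
have s1K : subZ1 \subset K.
  have c1 : #|subZ1_group| = (p * #|(1%G : {group gT})|)%N.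
    by rewrite cards1 muln1 -[RHS]card_Z1.
  apply: (mem_sub_prime_step c1 (sub1G _) (sub1G _) (groupR Kk Kg) Z1r).
  apply/set1P=> r1; move: rz; rewrite r1 coord_z1 => /esym/eqP.
  by rewrite -mulr_natr mulf_eq0 (negPf two_neq0) orbF oppr_eq0 mulf_eq0 (negPf
    k3) (negPf g0).
by apply: (@mem_sub_prime_step subZ1_group subZ2_group K k);
  rewrite /= ?subZ12 ?card_Z2 ?card_Z1 ?expnS ?expn0 ?muln1.
Qed.

Lemma comm_Z4 k g : k \in subZ4 -> g \in S ->
  [~ k, g] \in subZ3 /\ w2 [~ k, g] = (t g * w1 k *+ 2)%R.
Proof.
move=> Zk Sg; have [Sk tk k0] := subZ4_coord Zk.
have [Z4r r1 r2 _] := comm_coords (subsetP subZ4Q2 k Zk) Sg.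
by split; [rewrite inE Z4r r1 k0 mulr0 eqxx | rewrite r2 k0 mulr0 addr0].
Qed.

Lemma comm_Z3 k g : k \in subZ3 -> g \in S ->
  [~ k, g] \in subZ2 /\ w3 [~ k, g] = (t g * w2 k *+ 3)%R.
Proof.
move=> Zk Sg; have [Sk tk k0 k1] := subZ3_coord Zk.
have [Z4r r1 r2 r3] := comm_coords (subsetP (subset_trans subZ34 subZ4Q2) k Zk)
  Sg.
split; last by rewrite r3 k0 k1 !(mulr0, mul0rn, addr0).
by rewrite !inE; have [-> -> ->] := subZ4_coord Z4r;
  rewrite r1 r2 k0 k1 !(mulr0, mul0rn, addr0) !eqxx.
Qed.

Let mulrn_eq0 n (a : 'F_p) : (n%:R != 0 :> 'F_p)%R -> (a *+ n == 0)%R = (a ==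
  0)%R.
Proof. by move=> nz; rewrite -mulr_natr mulf_eq0 (negPf nz) orbF. Qed.

Lemma good_Z3 g k K : good g -> g \in K -> k \in K -> k \in subZ3 ->
  k \notin subZ2 -> subZ3 \subset K.
Proof.
move=> gg Kg Kk Z3k nZk; have /and3P[Sg gt g0] := gg.
have [Z2r r3] := comm_Z3 Z3k Sg.
have k2 : w2 k != 0%R by move: nZk; rewrite inE Z3k.
have s2K : subZ2 \subset K.
  apply: (good_subZ1 gg Kg (groupR Kk Kg) Z2r _).
  by rewrite inE Z2r /= r3 mulrn_eq0 // mulf_eq0 negb_or gt.
by apply: (@mem_sub_prime_step subZ2_group subZ3_group K k);
  rewrite /= ?subZ23 ?card_Z2 ?card_Z3 ?expnS.
Qed.

Lemma good_Z4 g k K : good g -> g \in K -> k \in K -> k \in subZ4 ->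
  k \notin subZ3 -> subZ4 \subset K.
Proof.
move=> gg Kg Kk Z4k nZk; have /and3P[Sg gt g0] := gg.
have [Z3r r3] := comm_Z4 Z4k Sg.
have k2 : w1 k != 0%R by move: nZk; rewrite inE Z4k.
have s3K : subZ3 \subset K.
  apply: (good_Z3 gg Kg (groupR Kk Kg) Z3r _).
  by rewrite inE Z3r /= r3 mulrn_eq0 // mulf_eq0 negb_or gt.
by apply: (@mem_sub_prime_step subZ3_group subZ4_group K k);
  rewrite /= ?subZ34 ?card_Z4 ?card_Z3 ?expnS.
Qed.

Lemma good_sub_Q2 g k K : good g -> g \in K -> k \in K -> k \in subQ2 ->
  k \notin subQ1 -> subQ2 \subset K.
Proof.
move=> gg Kg Kk Q2k nZk; have /and3P[Sg gt g0] := gg.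
have [Z4r r1 _ _] := comm_coords Q2k Sg.
have [Sk tk] := subQ2_coord Q2k.
have k0 : w0 k != 0%R by move: nZk; rewrite inE Sk.
have s4K : subZ4 \subset K.
  apply: (good_Z4 gg Kg (groupR Kk Kg) Z4r _).
  by rewrite inE Z4r /= r1 mulf_eq0 negb_or gt.
apply: (@mem_sub_prime_step subZ4_group subQ2_group K k);
  rewrite /= ?subZ4Q2 ?card_Z4 ?card_Q2 ?expnS //.
by rewrite inE Q2k.
Qed.

Lemma good_sub_Z2 g K : good g -> g \in K -> ~~ (K :&: subQ2 \subset subZ1) ->
  subZ2 \subset K.
Proof.
move=> gg Kg /subsetPn[k /setIP[Kk Q2k] nZ1k].
have [Z4k|nZ4k] := boolP (k \in subZ4); last first.
  apply: subset_trans subZ2Q2 (good_sub_Q2 gg Kg Kk Q2k _).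
  apply: contra nZ4k => /setIdP[_ k0]; by rewrite inE Q2k.
have [Z3k|nZ3k] := boolP (k \in subZ3); last first.
  exact: subset_trans (subset_trans subZ23 subZ34) (good_Z4 gg Kg Kk Z4k nZ3k).
have [Z2k|nZ2k] := boolP (k \in subZ2); last first.
  exact: subset_trans subZ23 (good_Z3 gg Kg Kk Z3k nZ2k).
exact: good_subZ1 gg Kg Kk Z2k nZ1k.
Qed.

(** * Q2 as an extraspecial group *)

Lemma Q2_expn_coords x n : x \in subQ2 ->
  [/\ w0 (x ^+ n) = w0 x *+ n, w1 (x ^+ n) = w1 x *+ n,
      w2 (x ^+ n) = w2 x *+ n & w3 (x ^+ n) = w3 x *+ n]%R.
Proof.
move=> Qx; have [Sx tx] := subQ2_coord Qx.
elim: n => [|n [E0 E1 E2 E3]].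
  by rewrite expg0 coord_w01 coord_w11 coord_w21 coord_w31 !mulr0n.
have [Sn tn] := subQ2_coord (groupX n Qx : x ^+ n \in subQ2_group).
by rewrite expgS cw0M ?cw1M ?cw2M ?cw3M // tn E0 E1 E2 E3 !mulrS; split; ring.
Qed.

(** The cubic of a central element lies in the radical of the symplectic form. Pairing it with the
    four unit cubics shows that the radical is zero, since 2 and 3 are invertible. *)
Lemma center_Q2 : 'Z(subQ2) = subZ1.
Proof.
apply/setP=> x; apply/idP/idP=> [/centerP[Qx cx]|Zx]; last first.
  have Qx := subsetP (subset_trans subZ12 subZ2Q2) x Zx.
  apply/centerP; split=> // y /subQ2_coord[Sy _]; exact: subZ1_central.
have [Sx tx] := subQ2_coord Qx.
have D a b c d : (w0 x * d - w1 x * c *+ 3 + w2 x * b *+ 3 - w3 x * a = 0)%R.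
  have [y Sy [[ty ya yb] yc yd _]] := coords_surj C 0%R a b c d 0%R.
  have Qy : y \in subQ2 by rewrite inE Sy ty eqxx.
  have F := congr1 z (cx y Qy); apply: (mulf_0 two_neq0).
  move: F; rewrite !czM // tx ty ya yb yc yd => F.
  by apply: (eq_by_sub F); ring.
have x0 : w0 x = 0%R by rewrite -[RHS](D 0 0 0 1)%R; ring.
have x3 : w3 x = 0%R by apply: oppr_inj; rewrite oppr0 -[RHS](D 1 0 0 0)%R;
  ring.
have x1 : w1 x = 0%R.
  by apply: (mulf_0 three_neq0); apply: oppr_inj;
    rewrite oppr0 -[RHS](D 0 0 1 0)%R; ring.
have x2 : w2 x = 0%R.
  by apply: (mulf_0 three_neq0); rewrite -[RHS](D 0 1 0 0)%R; ring.
by rewrite !inE Sx tx x0 x1 x2 x3 !eqxx.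
Qed.

Lemma comm_Q2 x y : x \in subQ2 -> y \in subQ2 -> [~ x, y] \in subZ1.
Proof.
move=> Qx Qy; have [Sy ty] := subQ2_coord Qy.
have [Z4 r1 r2 r3] := comm_coords Qx Sy; have [Sr tr r0] := subZ4_coord Z4.
by rewrite !inE Sr tr r0 r1 r2 r3 ty expr0n !(mul0r, mul0rn, addr0) !eqxx.
Qed.

(** Needed for the order formula for centralizers of subgroups, which replaces linear algebra in the
    symplectic space [subQ2 / subZ1]. *)
Lemma extraspecial_Q2 : extraspecial subQ2.
Proof.
have pQ2 : p.-group subQ2 by apply: (sub_pgroup (K := subQ2_group));
  exact: subQ2S.
have nZQ : subQ2 \subset 'N(subZ1) by rewrite -center_Q2;
  exact: normal_norm (center_normal _).
have der_sub : subQ2^`(1) \subset subZ1.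
  rewrite gen_subG; apply/subsetP=> _ /imset2P[x y Qx Qy ->]; exact: comm_Q2.
have der_nt : subQ2^`(1) != 1.
  apply: contraTneq isT => /derG1P/center_idP; rewrite center_Q2 => E.
  have := card_Q2; rewrite -E card_Z1 -[X in X = _]expn1 => /eqP.
  by rewrite eqn_exp2l // prime_gt1.
have derE : subQ2^`(1) = subZ1.
  apply/eqP; rewrite eqEcard der_sub card_Z1.
  have : #|subQ2^`(1)| %| p by rewrite -[X in _ %| X]card_Z1 (cardSg (G :=
    subZ1_group)).
  case/primeP: p_pr => _ /[apply]/orP[|/eqP->]; last by rewrite leqnn.
  by rewrite -trivg_card1 (negPf der_nt).
have Phi_sub : 'Phi(subQ2) \subset subZ1.
  apply: (Phi_min (G := subQ2_group) (H := subZ1_group) pQ2 nZQ).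
  apply/(abelemP p_pr); split; first by rewrite sub_der1_abelian.
  move=> _ /morphimP[x nx Qx ->]; rewrite -morphX //; apply: coset_id.
  have [E0 E1 E2 E3] := Q2_expn_coords p Qx.
  have [Sxp txp] := subQ2_coord (groupX p Qx : x ^+ p \in subQ2_group).
  have pn0 (a : 'F_p) : (a *+ p = 0)%R.
    by rewrite -mulr_natr (pcharf0 (pchar_Fp p_pr)) mulr0.
  by rewrite !inE Sxp txp E0 E1 E2 E3 !pn0 !eqxx.
split; last by rewrite center_Q2 card_Z1.
split; rewrite center_Q2 //; apply/eqP; rewrite eqEsubset Phi_sub -derE.
by rewrite (Phi_joing (P := subQ2_group) pQ2) joing_subl.
Qed.

Lemma card_cent_Q2 A : A \subset subQ2 ->
  (#|'C_subQ2(A)| * #|A| = #|subZ1 :&: A| * p ^ 5)%N.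
Proof.
move=> sAQ; have pQ2 : p.-group subQ2.
  by apply: (sub_pgroup (K := subQ2_group)); exact: subQ2S.
rewrite (card_subcent_extraspecial (G := subQ2_group) pQ2 extraspecial_Q2) //=.
rewrite center_Q2 -mulnA -card_Q2; congr (_ * _)%N.
by rewrite mulnC (Lagrange (G := subQ2_group)).
Qed.

(** The order formula applied twice gives A and its double centralizer the same order. In
    [subQ2 / subZ1] this says that a subspace is the orthogonal of its orthogonal. *)
Lemma double_cent_Q2 A : A \subset subQ2 -> subZ1 \subset A ->
  'C_subQ2('C_subQ2(A)) = A.
Proof.
move=> sAQ sZA; apply/esym/eqP; rewrite eqEcard subsetI sAQ.
rewrite centsC subsetIr /=.
have E1 := card_cent_Q2 sAQ.
have sZC : subZ1 \subset 'C_subQ2(A).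
  by rewrite -center_Q2 subsetI subsetIl subIset // orbC centS.
have E2 := card_cent_Q2 (A := [group of 'C_subQ2(A)]) (subsetIl _ _).
move: E1 E2; rewrite /= (setIidPl sZA) (setIidPl sZC) => <- /eqP.
rewrite [X in _ == X]mulnC eqn_pmul2r ?cardG_gt0 // => /eqP->.
exact: leqnn.
Qed.

(** * Self-centralizing subgroups of S *)

Lemma leq_card_p (K : {group gT}) k : K \subset S -> (p ^ k < #|K|)%N ->
  (p ^ k.+1 <= #|K|)%N.
Proof.
move=> /sub_pgroup/p_natP[m ->].
by rewrite ltn_exp2l ?(prime_gt1 p_pr) // => lt_km;
  rewrite leq_exp2l ?(prime_gt1 p_pr).
Qed.

Lemma subZ1_cent K : K \subset S -> subZ1 \subset 'C(K).
Proof.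
move=> sKS; apply/subsetP=> x Zx; apply/centP=> y Ky.
by apply: subZ1_central; rewrite ?(subsetP sKS).
Qed.

Lemma subZ2_cent K : K \subset subQ1 -> subZ2 \subset 'C(K).
Proof.
move=> sKQ; apply/subsetP=> x Zx; apply/centP=> y Ky.
by apply: subZ2_Q1_commute; rewrite ?(subsetP sKQ).
Qed.

Lemma cent_subZ2 K : subZ2 \subset K -> 'C_S(K) \subset subQ1.
Proof.
move=> sZK; have /subsetPn[k Zk nZk] : ~~ (subZ2 \subset subZ1).
  apply/negP=> /subset_leq_card;
    rewrite card_Z1 card_Z2 leqNgt -[X in (X < _)%N]expn1.
  by rewrite ltn_exp2l ?(prime_gt1 p_pr).
apply/subsetP=> x /setIP[Sx /centP cx].
by apply: (subZ2_cent1 Zk nZk Sx); apply/commute_sym/cx/(subsetP sZK).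
Qed.

Lemma cent_subQ2 K m : m \in K -> m \in subQ2 -> m \notin subQ1 ->
  'C_S(K) \subset subQ2.
Proof.
move=> Km Qm nQm; apply/subsetP=> x /setIP[Sx /centP cx].
by apply: (Q2_cent1 Qm nQm Sx); apply/commute_sym/cx.
Qed.

Lemma good_gt_Z2 g K : K \subset S -> good g -> g \in K -> (p ^ 3 <= #|K|)%N ->
  subZ2 \subset K.
Proof.
move=> sKS gg Kg leK; apply: (good_sub_Z2 gg Kg); apply/negP=> /subset_leq_card.
rewrite card_Z1 => le1; have := leq_trans leK (leq_card_Q2 sKS).
rewrite expnS leq_pmul2l ?(prime_gt0 p_pr) // => /leq_trans/(_ le1).
by rewrite -[X in (_ <= X)%N]expn1 leq_exp2l ?(prime_gt1 p_pr).
Qed.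

(** C_S(K) lies in C_S(g), which has order at most p^2 and therefore equals the subgroup generated
    by g and [subZ1]. That subgroup is in K, since the order of K forces [subZ2] into K. *)
Lemma good_centric g K : K \subset S -> good g -> g \in K ->
  (p ^ 3 <= #|K|)%N -> 'C_S(K) \subset K.
Proof.
move=> sKS gg Kg leK; have sZ2K := good_gt_Z2 sKS gg Kg leK.
have sZ1K := subset_trans subZ12 sZ2K.
have /andP[_ nQg] := good_notin gg; have /and3P[Sg _ _] := gg.
pose A := (<[g]> <*> subZ1_group)%G; pose B := ('C_S[g])%G.
have sAB : A \subset B.
  rewrite join_subG cycle_subG /= inE Sg cent1id subsetI.
  rewrite (subset_trans subZ12 subZ2S) /=.
  by rewrite -cent_cycle subZ1_cent // cycle_subG.
have leA : (p ^ 2 <= #|A|)%N.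
  apply: leq_card_p; first by rewrite (subset_trans sAB) ?subsetIl.
  rewrite expn1 -card_Z1 proper_card // properE joing_subr.
  apply: contra nQg => sAZ.
  have sAQ := subset_trans sAZ (subset_trans subZ12 subZ2Q2).
  by apply: (subsetP sAQ); rewrite mem_gen // inE cycle_id.
have leB : (#|B| <= p ^ 2)%N by apply: (good_cent1 _ gg);
  rewrite ?subsetIl ?subsetIr.
have eAB : A = B by apply/val_inj/eqP; rewrite eqEcard sAB (leq_trans leB).
have sAK : A \subset K by rewrite join_subG cycle_subG Kg.
apply: subset_trans sAK; rewrite eAB setIS //= -cent_cycle centS //.
by rewrite cycle_subG.
Qed.

Lemma good_cent_le g N : N \subset S -> good g -> (#|'C_N[g]| <= p ^ 2)%N.
Proof.
move=> sNS gg; apply: (good_cent1 (K := ('C_N[g])%G) _ gg);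
  last exact: subsetIr.
by rewrite subIset ?sNS.
Qed.

(** With [good_cent_le] this separates good elements of N from the others by centralizer order. The
    centralizer of n in N contains [N :&: subQ1] if n is in [subZ2], of index at most p in N. It
    contains n and [subZ2] if n is in [subQ1] but not in [subZ2]. Otherwise N contains [subQ2],
    where n has a centralizer of order p^4. *)
Lemma not_good_cent_ge g n N : N \subset S -> good g -> g \in N ->
  (p ^ 4 <= #|N|)%N -> n \in N -> ~~ good n -> (p ^ 3 <= #|'C_N[n]|)%N.
Proof.
move=> sNS gg Ng leN Nn; rewrite /good (subsetP sNS n Nn) /= negb_and !negbK.
have Sn := subsetP sNS n Nn.
have sZ2N : subZ2 \subset N.
  by apply: (good_gt_Z2 sNS gg Ng);
    rewrite (leq_trans _ leN) // leq_exp2l ?(prime_gt1 p_pr).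
move=> n0; have [Qn|nQn] := boolP (n \in subQ1).
  have [Zn|nZn] := boolP (n \in subZ2).
    have := leq_trans leN (leq_card_Q1 sNS).
    rewrite expnS leq_pmul2l ?(prime_gt0 p_pr) // => /leq_trans-> //.
    apply/subset_leq_card/subsetP=> x /setIP[Nx Qx]; rewrite inE Nx.
    by apply/cent1P/commute_sym; apply: subZ2_Q1_commute.
  have sAN : (<[n]> <*> subZ2_group)%G \subset ('C_N[n])%G.
    rewrite join_subG cycle_subG /= inE Nn cent1id subsetI sZ2N /=.
    by rewrite -cent_cycle subZ2_cent // cycle_subG.
  apply: leq_trans (subset_leq_card sAN); apply: leq_card_p.
    by rewrite (subset_trans sAN) // subIset ?sNS.
  rewrite -card_Z2 proper_card // properE joing_subr.
  by apply: contra nZn => /subsetP->; rewrite // mem_gen // inE cycle_id.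
have Qn : n \in subQ2.
  by move: n0 nQn; rewrite !inE Sn /= => /orP[//|->].
have sQN := good_sub_Q2 gg Ng Nn Qn nQn.
have pQ2 : p.-group subQ2_group := sub_pgroup (K := subQ2_group) subQ2S.
pose B := ('C_subQ2[n])%G.
have maxB : maximal B subQ2_group.
  apply: (cent1_extraspecial_maximal (G := subQ2_group) extraspecial_Q2 Qn).
  rewrite center_Q2; apply: contra nQn.
  exact: subsetP (subset_trans subZ12 subZ2Q1) n.
have sBQ : B \subset subQ2_group by apply: subsetIl.
have := Lagrange sBQ; rewrite (p_maximal_index pQ2 maxB) /= card_Q2.
rewrite expnSr => /eqP; rewrite eqn_pmul2r ?(prime_gt0 p_pr) // => /eqP cB.
apply: (@leq_trans (p ^ 4)); first by rewrite leq_exp2l ?(prime_gt1 p_pr).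
by rewrite -cB subset_leq_card // setSI.
Qed.

(** If A lies in [subQ1], it contains some y outside [subZ2], so A is all of ['C_subQ1[y]] by order
    and contains [subZ2], which confines C_S(A) to [subQ1]. A good element in A would bound its
    order by p^2. In the remaining case C_S(A) lies in [subQ2], where the order formula bounds it by
    p^3. *)
Lemma abelian_self_centralizing A : A \subset S -> abelian A ->
  (p ^ 3 <= #|A|)%N -> 'C_S(A) \subset A.
Proof.
move=> sAS cAA leA.
have lt23 : (p ^ 2 < p ^ 3)%N by rewrite ltn_exp2l ?(prime_gt1 p_pr).
have cA1 x : x \in A -> A \subset 'C[x].
  by move=> Ax; rewrite -cent_cycle; apply: subset_trans cAA (centS _);
    rewrite cycle_subG.
have [sAQ1|nAQ1] := boolP (A \subset subQ1).
  have /subsetPn[y Ay nZy] : ~~ (A \subset subZ2).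
    apply/negP=> /subset_leq_card; rewrite card_Z2 leqNgt.
    by rewrite (leq_trans lt23 leA).
  have Qy := subsetP sAQ1 y Ay.
  pose B := ('C_subQ1[y])%G.
  have leB : (#|B| <= p ^ 3)%N.
    by apply: (Q1_cent1 Qy nZy); rewrite ?subsetIl ?subsetIr.
  have eAB : A = B.
    by apply/val_inj/eqP; rewrite eqEcard subsetI sAQ1 cA1 //= (leq_trans leB).
  have sZ2A : subZ2 \subset A.
    rewrite eAB /B /= subsetI subZ2Q1 -cent_cycle; apply: subZ2_cent.
    by rewrite cycle_subG.
  have sBA : 'C_subQ1[y] \subset A by rewrite eAB.
  apply: subset_trans sBA; rewrite subsetI cent_subZ2 // -cent_cycle.
  by rewrite subIset // orbC centS // cycle_subG.
have [sAQ2|nAQ2] := boolP (A \subset subQ2); last first.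
  have [g Ag gg] := exists_good sAS nAQ1 nAQ2.
  by have := leq_trans leA (good_cent1 sAS gg (cA1 g Ag)); rewrite leqNgt lt23.
have /subsetPn[m Am nQm] := nAQ1.
have sCC : 'C_S(A) \subset 'C_subQ2(A).
  by rewrite subsetI (cent_subQ2 Am (subsetP sAQ2 m Am) nQm) subsetIr.
apply: subset_trans sCC _.
suff /eqP <- : A :==: 'C_subQ2(A) by [].
rewrite eqEcard subsetI sAQ2 -abelianE cAA /=.
rewrite -(leq_pmul2r (cardG_gt0 A)) card_cent_Q2 //.
apply: leq_trans (leq_mul leA leA);
  rewrite -expnD (expnD p 1 5) leq_mul2r expn1.
by rewrite -[X in (_ <= X)%N]card_Z1 subset_leq_card ?subsetIl ?orbT.
Qed.

(** For M in [subQ1], such an M contains [subZ2] but is not inside it, as otherwise [subQ1] would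
    centralize M; any further element y and [subZ2] generate A. For M in [subQ2], a maximal abelian
    subgroup of M is taken. *)
Lemma exists_abelian_sub M : M \subset S ->
    (M \subset subQ1) || (M \subset subQ2) -> 'C_S(M) \subset M ->
  exists A : {group gT}, [/\ A \subset M, abelian A & (p ^ 3 <= #|A|)%N].
Proof.
move=> sMS + cM; case: (boolP (M \subset subQ1)) => [sMQ _|_ /= sMQ].
  have sZM : subZ2 \subset M.
    by apply: (subset_trans _ cM); rewrite subsetI subZ2S subZ2_cent.
  have /subsetPn[y My nZy] : ~~ (M \subset subZ2).
    apply/negP=> sMZ; suff /subset_leq_card : subQ1 \subset subZ2.
      by rewrite card_Q1 card_Z2 leq_exp2l ?(prime_gt1 p_pr).
    apply: (subset_trans _ sMZ); apply: (subset_trans _ cM);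
      rewrite subsetI subQ1S.
    by rewrite (subset_trans _ (centS sMZ)) // centsC subZ2_cent.
  have Qy := subsetP sMQ y My.
  exists (<[y]> <*> subZ2_group)%G; split.
  - by rewrite join_subG cycle_subG My.
  - rewrite abelianY cycle_abelian /=; apply/andP; split.
      exact: (subZ2_cent (K := subZ2_group) subZ2Q1).
    by rewrite subZ2_cent // cycle_subG.
  apply: leq_card_p.
    by rewrite join_subG cycle_subG (subsetP sMS) //= subZ2S.
  rewrite -card_Z2 proper_card // properE joing_subr.
  by apply: contra nZy => /subsetP->; rewrite // mem_gen // inE cycle_id.
have sZM : subZ1 \subset M.
  apply: subset_trans cM; rewrite subsetI subZ1_cent // andbT.
  exact: subset_trans subZ12 subZ2S.
have [A maxA _] : {A : {group gT} | [max A | (A \subset M) && abelian A] & 1%G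
  \subset A}.
  by apply: (maxgroup_exists (G := 1%G)); rewrite sub1G abelian1.
have /maxgroupP[/andP[sAM cAA] maxAM] := maxA.
have cMA : 'C_M(A) \subset A.
  apply/subsetP=> x /setIP[Mx cAx].
  have /= <- : (<[x]> <*> A)%G :=: A; last by rewrite mem_gen // inE cycle_id.
  apply: maxAM; last exact: joing_subr.
  by rewrite join_subG cycle_subG Mx sAM abelianY cycle_abelian cAA centsC
    cycle_subG.
(* C_Q2(M) lies in M, hence in A. Taking centralizers again bounds C_Q2(A) by C_Q2(C_Q2(M)) = M, so
   A is self-centralizing in all of Q2, and the order formula gives |A|^2 >= p^6. *)
have sCQA : 'C_subQ2(A) \subset A.
  have sCQM : 'C_subQ2(M) \subset A.
    apply: subset_trans cMA; rewrite subsetI (subset_trans _ cM) ?setSI ?subQ2S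
      //=.
    by rewrite subIset // orbC centS.
  have := setIS subQ2 (centS sCQM); rewrite double_cent_Q2 // => sCM.
  by apply: subset_trans cMA; rewrite subsetI sCM subsetIr.
exists A; split=> //.
have sZA : subZ1 \subset A.
  apply: subset_trans cMA; rewrite subsetI sZM subZ1_cent //.
  exact: subset_trans sAM sMS.
have := card_cent_Q2 (subset_trans sAM sMQ);
  rewrite (setIidPl sZA) card_Z1 -expnS => E.
have := leq_mul (subset_leq_card sCQA) (leqnn #|A|);
  rewrite E -[X in (X <= _)%N]/(p ^ (3 * 2))%N expnM.
by rewrite mulnn leq_exp2r.
Qed.

(** * Two centric subgroups with a non-centric intersection *)

Lemma subZ2_norm K : K \subset S -> K \subset 'N(subZ2).
Proof.
move=> sKS; apply: subset_trans sKS _; rewrite -[subZ2]/(gval subZ2_group).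
rewrite -commg_subl gen_subG; apply/subsetP=> _ /imset2P[k g Zk Sg ->].
by have [Zr _] := comm_Z2 Zk Sg; apply: (subsetP subZ12).
Qed.

Lemma coord_w0V x : x \in S -> w0 x^-1 = (- w0 x)%R.
Proof.
by move=> Sx; apply: (addrI (w0 x));
  rewrite -cw0M ?groupV // mulgV coord_w01 subrr.
Qed.

Lemma coord_w0X x n : x \in S -> w0 (x ^+ n) = (w0 x *+ n)%R.
Proof.
move=> Sx; elim: n => [|n IH]; first by rewrite coord_w01 mulr0n.
by rewrite expgS cw0M ?groupX // IH mulrS.
Qed.

Lemma exists_expn_Q1 x y : x \in S -> x \notin subQ1 -> y \in S ->
  exists n, y * x ^- n \in subQ1.
Proof.
move=> Sx nQx Sy; have x0 : w0 x != 0%R by move: nQx; rewrite inE Sx.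
exists ((w0 y / w0 x)%R : 'F_p); rewrite inE groupM ?groupV ?groupX //=.
rewrite cw0M ?groupV ?groupX // coord_w0V ?groupX // coord_w0X // -mulr_natr.
by rewrite (natr_Zp (w0 y / w0 x)%R) mulrC divfK // subrr.
Qed.

(* fc stands for being F-centric. *)
Lemma intersection_dichotomy (fc : pred {group gT}) P R M :
    (forall K, K \subset S -> fc K -> 'C_S(K) \subset K) ->
    (forall K L, K \subset L -> L \subset S -> fc K -> fc L) ->
    (forall K g, K \subset S -> good g -> g \in K -> (p ^ 3 <= #|K|)%N -> fc K)
      ->
    (forall K A, K \subset S -> A \subset K -> abelian A -> (p ^ 3 <= #|A|)%N ->
       fc K) ->
    P \subset S -> R \subset S -> fc P -> fc R -> ~~ fc (P :&: R)%G ->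
    M \subset P :&: R -> ~~ fc M ->
  'C_P(M) \subset M -> exists x y,
    [/\ x \in 'N_P(M), y \in 'N_R(M), y \notin P & y * x^-1 \in 'C(M)].
Proof.
move=> fc_cent fc_sub fc_good fc_ab sPS sRS fcP fcR nfcT sMT nfcM cPM.
have /andP[sMP sMR] : (M \subset P) && (M \subset R) by rewrite -subsetI.
have sMS := subset_trans sMP sPS.
(* An element c of C_R(M) outside M is also outside P, because C_P(M) is in M; it acts on M like 1.
   Afterwards M is self-centralizing in both P and R. *)
have [cRM|/subsetPn[c /setIP[Rc cMc] nMc]] := boolP ('C_R(M) \subset M);
  last first.
  exists 1, c; rewrite group1 inE Rc (subsetP (cent_sub M)) // invg1 mulg1.
  by split=> //; apply: contra nMc => Pc; rewrite (subsetP cPM) // inE Pc.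
have sZ1 K : K \subset S -> fc K -> subZ1 \subset K.
  move=> sKS fcK; apply: subset_trans (fc_cent K sKS fcK).
  by rewrite subsetI (subset_trans subZ12 subZ2S) subZ1_cent.
have sZ1M : subZ1 \subset M.
  by apply: subset_trans cPM; rewrite subsetI sZ1 // subZ1_cent.
have not_bad : ((M \subset subQ1) || (M \subset subQ2)) -> ~~ ('C_S(M) \subset
  M).
  move=> bM; apply: contra nfcM => cM.
  have [A [sAM cAA leA]] := exists_abelian_sub sMS bM cM.
  exact: fc_ab sMS sAM cAA leA.
(* Since C_Q2(P) lies in M, the double centralizer property puts C_Q2(M) into P, hence into
   C_P(M). *)
have sub_Q2 : P \subset subQ2 -> 'C_subQ2(M) \subset M.
  move=> sPQ; have sCP : 'C_subQ2(P) \subset M.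
    apply: subset_trans cPM; rewrite subsetI; apply/andP; split.
      by apply: subset_trans (fc_cent P sPS fcP); rewrite setSI ?subQ2S.
    by rewrite subIset // orbC centS.
  have := setIS subQ2 (centS sCP); rewrite double_cent_Q2 ?sZ1 // => sCM.
  by apply: subset_trans cPM; rewrite subsetI sCM subsetIr.
have [sMQ1|nMQ1] := boolP (M \subset subQ1); last first.
  have [sMQ2|nMQ2] := boolP (M \subset subQ2).
    have /subsetPn[m Mm nQm] := nMQ1.
    have Q2m := subsetP sMQ2 m Mm.
    case/negP: (not_bad (introT orP (or_intror sMQ2))).
    have sCC : 'C_S(M) \subset 'C_subQ2(M).
      by rewrite subsetI (cent_subQ2 Mm Q2m nQm) subsetIr.
    apply: subset_trans sCC _; have [/sub_Q2//|nPQ2] := boolP (P \subset subQ2).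
    have [|g Pg gg] := exists_good sPS _ nPQ2.
      by apply: contra nQm => /subsetP->; rewrite ?(subsetP sMP).
    have sQP := good_sub_Q2 gg Pg (subsetP sMP m Mm) Q2m nQm.
    by apply: subset_trans cPM; rewrite setSI.
  (* Here M has order exactly p^2, since it is not centric. P and R are larger, so both contain
     [subZ2]; then T contains [subZ2] and g, and is a good subgroup of order at least p^3. *)
  have [g Mg gg] := exists_good sMS nMQ1 nMQ2.
  have ltM : (#|M| < p ^ 3)%N.
    by rewrite ltnNge; apply: contra nfcM; apply: fc_good gg Mg.
  have /andP[_ nQg] := good_notin gg.
  have nZ2g : g \notin subZ2 by apply: contra nQg; apply: subsetP subZ2Q2 g.
  have leM : (p ^ 2 <= #|M|)%N.
    apply: leq_card_p => //; rewrite expn1 -card_Z1 proper_card // properE sZ1M.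
    by apply: contra nZ2g => /subsetP/(_ g Mg)/(subsetP subZ12).
  have sZ2 K : M \subset K -> K \subset S -> fc K -> subZ2 \subset K.
    move=> sMK sKS fcK; apply: (good_sub_Z2 gg); first exact: (subsetP sMK).
    apply: contra nfcM => sKZ; suff -> : M = K by [].
    apply/val_inj/eqP; rewrite eqEcard sMK (leq_trans _ leM) //.
    apply: leq_trans (leq_card_Q2 sKS) _;
      rewrite expnS expn1 leq_pmul2l ?(prime_gt0 p_pr) //.
    by rewrite -[X in (_ <= X)%N]card_Z1 subset_leq_card.
  case/negP: nfcT; apply: (fc_good _ g) => //; first by rewrite subIset ?sPS.
    exact: (subsetP sMT).
  apply: leq_card_p; first by rewrite subIset ?sPS.
  rewrite -card_Z2 proper_card // properE subsetI !sZ2 //=.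
  by apply: contra nZ2g => /subsetP->; rewrite // (subsetP sMT).
(* If [subZ2] is not in M, it is not in P either, since it centralizes M. This leaves a good P of
   order at most p^2 and M = [subZ1], which P centralizes, so P would lie in M. *)
have [sZ2M|nZ2M] := boolP (subZ2 \subset M); last first.
  have nZ2P : ~~ (subZ2 \subset P).
    apply: contra nZ2M => sZ2P; apply: subset_trans cPM.
    by rewrite subsetI sZ2P subZ2_cent.
  have nPQ1 : ~~ (P \subset subQ1).
    apply: contra nZ2P => sPQ; apply: subset_trans (fc_cent P sPS fcP).
    by rewrite subsetI subZ2S subZ2_cent.
  have [sPQ2|nPQ2] := boolP (P \subset subQ2).
    case/negP: nZ2M; apply: subset_trans (sub_Q2 sPQ2).
    by rewrite subsetI subZ2Q2 subZ2_cent.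
  have [g Pg gg] := exists_good sPS nPQ1 nPQ2.
  have leP : (#|P| <= p ^ 2)%N.
    apply: leq_trans (leq_card_Q2 sPS) _;
      rewrite expnS expn1 leq_pmul2l ?(prime_gt0 p_pr) //.
    rewrite -[X in (_ <= X)%N]card_Z1 subset_leq_card //.
    by apply: contraR nZ2P; apply: good_sub_Z2 gg Pg.
  have nPM : ~~ (P \subset M) by apply: contra nPQ1 => /subset_trans->.
  have eMZ : M = subZ1_group.
    apply/esym/val_inj/eqP; rewrite eqEcard sZ1M /= card_Z1 -[X in (_ <=
      X)%N]expn1.
    rewrite leqNgt; apply: contra nPM => ltM.
    have leM := leq_card_p sMS ltM.
    suff -> : P = M by [].
    by apply/esym/val_inj/eqP; rewrite eqEcard sMP (leq_trans leP).
  case/negP: nPM; apply: subset_trans cPM; rewrite subsetI subxx centsC eMZ.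
  exact: subZ1_cent.
have cSQ := cent_subZ2 sZ2M.
(* For y in M outside [subZ2], C_Q1(y) is generated by y and [subZ2] and so lies in M. It contains
   C_S(M), against [not_bad]. *)
have [sMZ2|/subsetPn[y My nZy]] := boolP (M \subset subZ2); last first.
  case/negP: (not_bad (introT orP (or_introl sMQ1))).
  have Qy := subsetP sMQ1 y My.
  pose B := ('C_subQ1[y])%G; pose A := (<[y]> <*> subZ2_group)%G.
  have leB : (#|B| <= p ^ 3)%N.
    by apply: (Q1_cent1 Qy nZy); rewrite ?subsetIl ?subsetIr.
  have sAB : A \subset B.
    rewrite join_subG cycle_subG /= inE Qy cent1id subsetI subZ2Q1 /=.
    by rewrite -cent_cycle subZ2_cent // cycle_subG.
  have leA : (p ^ 3 <= #|A|)%N.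
    apply: leq_card_p; first by rewrite (subset_trans sAB) // subIset ?subQ1S.
    rewrite -card_Z2 proper_card // properE joing_subr.
    by apply: contra nZy => /subsetP->; rewrite // mem_gen // inE cycle_id.
  have eAB : A = B by apply/val_inj/eqP; rewrite eqEcard sAB (leq_trans leB).
  have sAM : A \subset M by rewrite join_subG cycle_subG My.
  apply: subset_trans sAM; rewrite eAB /B /= subsetI cSQ -cent_cycle.
  by rewrite subIset // orbC centS // cycle_subG.
have eMZ : M = subZ2_group by apply/val_inj/eqP; rewrite eqEsubset sMZ2.
have not_Q1 K : M \subset K -> K \subset S -> fc K -> 'C_K(M) \subset M ->
    exists2 x, x \in K & x \notin subQ1.
  move=> sMK sKS fcK cKM; apply/subsetPn; apply: contra nfcM => sKQ.
  suff -> : M = K by [].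
  apply/val_inj/eqP; rewrite eqEsubset sMK; apply: subset_trans cKM.
  by rewrite subsetI subxx centsC eMZ subZ2_cent.
have [x Px nQx] := not_Q1 P sMP sPS fcP cPM.
have [y Ry nQy] := not_Q1 R sMR sRS fcR cRM.
have [Sx Sy] := (subsetP sPS x Px, subsetP sRS y Ry).
have cQ1 : subQ1 \subset 'C(M) by rewrite centsC eMZ subZ2_cent.
have [n Qyx] := exists_expn_Q1 Sx nQx Sy.
exists (x ^+ n), y; split; last exact: (subsetP cQ1).
- by rewrite in_setI groupX // eMZ (subsetP (subZ2_norm sPS)) ?groupX.
- by rewrite in_setI Ry eMZ (subsetP (subZ2_norm sRS)).
(* If y were in P, every u in P would be a power of y up to a factor in C_P(M), hence in M. Then P
   would lie in R and T = P would be centric. *)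
apply: contra nfcT => Py.
have sPT : P \subset (P :&: R)%G.
  apply/subsetP=> u Pu; have [k Quy] :=
    exists_expn_Q1 Sy nQy (subsetP sPS u Pu).
  have Mu : u * y ^- k \in M.
    by rewrite (subsetP cPM) // inE groupM ?groupV ?groupX //= (subsetP cQ1).
  have Ty : y \in (P :&: R)%G by rewrite /= in_setI Py.
  rewrite -(mulgKV (y ^+ k) u); apply: groupM (groupX k Ty).
  exact: (subsetP sMT).
by apply: fc_sub sPT _ fcP; rewrite subIset ?sPS.
Qed.

End Coordinates.

(** * Sylow subgroups of G2(p) *)

Lemma mem_norm_comm (gT : finGroupType) (U : {group gT}) n u :
  n \in 'N(U) -> u \in U -> exists2 v, v \in U & n * u = v * n.
Proof.
move=> nN Uu; exists (u ^ n^-1); first by rewrite memJ_norm ?groupV.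
by rewrite conjgE invgK !mulgA mulgKV.
Qed.

(** A proper subgroup of a p-group is properly contained in its normalizer there. This proves the
    Sylow property without the order of G. *)
Lemma Sylow_norm_sub (gT : finGroupType) (p : nat) (G U : {group gT}) :
    U \subset G -> p.-group U ->
    (forall n k, n \in G -> n \in 'N(U) -> n ^+ (p ^ k) = 1 -> n \in U) ->
  p.-Sylow(G) U.
Proof.
move=> sUG pU sub_norm; have [S sylS sUS] := Sylow_superset sUG pU.
have [sSG pS _] := and3P sylS.
suff <- : S :=: U by [].
apply: (nilpotent_sub_norm (pgroup_nil pS) sUS).
apply/subsetP=> n /setIP[Sn nUn]; have [k ok] := p_natP (mem_p_elt pS Sn).
by apply: (sub_norm n k); rewrite -?ok ?expg_order ?(subsetP sSG).
Qed.

Lemma coords_conj p (gT : finGroupType) (U S : {group gT}) x :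
  G2_coords p U -> S :=: U :^ x -> G2_coords p S.
Proof.
move=> cu defS.
have UE s : s \in S -> s ^ x^-1 \in U by rewrite defS mem_conjg.
pose J (f : gT -> 'F_p) s := f (s ^ x^-1).
refine (@G2Coords p _ S (J (ct cu)) (J (cw0 cu)) (J (cw1 cu)) (J (cw2 cu))
          (J (cw3 cu)) (J (cz cu)) _ _ _ _ _ _ _ _); rewrite /J.
- by move=> s u /UE Us /UE Uu; rewrite conjMg ctM.
- by move=> s u /UE Us /UE Uu; rewrite conjMg cw0M.
- by move=> s u /UE Us /UE Uu; rewrite conjMg cw1M.
- by move=> s u /UE Us /UE Uu; rewrite conjMg cw2M.
- by move=> s u /UE Us /UE Uu; rewrite conjMg cw3M.
- by move=> s u /UE Us /UE Uu; rewrite conjMg czM.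
- move=> s u /UE Us /UE Uu E0 E1 E2 E3 E4 E5; apply: (conjg_inj x^-1).
  exact: (coords_inj (g := cu)).
move=> t w0 w1 w2 w3 z; have [s Us Es] := coords_surj cu t w0 w1 w2 w3 z.
by exists (s ^ x); rewrite ?conjgK // defS memJ_conjg.
Qed.

(** * The six-parameter unipotent group of octonion automorphisms *)

Section Unipotent.

Variable p : nat.
Hypothesis p_pr : prime p.
Local Notation F := 'F_p.
Local Notation GL8 := {'GL_8['F_p]}.
Local Open Scope ring_scope.
Implicit Types g h : GL8.

Definition mx8 g : 'M[F]_8 := @GLval 8 F g.
(** This parameter and the next five are each read off at an entry of [umx] where they stand
    alone. *)
Definition umx_al g := mx8 g (inord 6) (inord 1).
Definition umx_be g := mx8 g (inord 5) (inord 6).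
Definition umx_ga g := mx8 g (inord 5) (inord 1).
Definition umx_c g := mx8 g (inord 4) (inord 0).
Definition umx_d2 g := mx8 g (inord 4) (inord 5).
Definition umx_d3 g := mx8 g (inord 4) (inord 6).

Definition unip_G2 : {set GL8} :=
  [set g | mx8 g == umx (umx_al g) (umx_be g) (umx_ga g)
                        (umx_c g) (umx_d2 g) (umx_d3 g)].

Lemma umx_params g a b e f d k : mx8 g = umx a b e f d k ->
  [/\ [/\ umx_al g = a, umx_be g = b & umx_ga g = e],
      umx_c g = f, umx_d2 g = d & umx_d3 g = k].
Proof.
rewrite /umx_al /umx_be /umx_ga /umx_c /umx_d2 /umx_d3 => ->.
by do !split; rewrite !mxE !inordK //= mxE inordK.
Qed.

Lemma mem_unip g a b e f d k : mx8 g = umx a b e f d k -> g \in unip_G2.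
Proof. by move=> E; rewrite inE E;
  have [[-> -> ->] -> -> ->] := umx_params E. Qed.

Lemma mx8M g h : mx8 (g * h)%g = mx8 g *m mx8 h.
Proof. by []. Qed.

(** The product formula is triangular: every parameter of the second factor enters its own component
    additively, next to terms in earlier ones. The parameters of a right inverse are thus found one
    after another. *)
Lemma umx_unit (a b e f d k : F) : umx a b e f d k \in unitmx.
Proof.
have solve (x y : F) : exists u, x + u + y = 0.
  by exists (- x - y); rewrite addrA subrr sub0r addNr.
have [ga' E3] := solve e (- a * b).
have [c' E4] := solve f (- a * e - a * ga' - a * - a * b).
have [d2' E5] := solve d (- a * f *+ 2 - a * c' + (- a) ^+ 2 * e - a * - a * ga'
     - a * (- a) ^+ 2 * b).
have [d3' E6] := solve k (- b * d + c' * e - ga' * f *+ 2 + - a * - b * f *+ 2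
     - - a * e * ga' - a * - b * c' - a * b * c' + a * ga' ^+ 2
     + (- a) ^+ 2 * - b * e - a * - a * - b * ga' + a * - a * b * ga'
     - a * (- a) ^+ 2 * b * - b).
suff /mulmx1_unit[-> _] : umx a b e f d k *m umx (- a) (- b) ga' c' d2' d3' =
  1%:M by [].
rewrite umx_mul -umx0; congr umx; first exact: subrr; first exact: subrr.
- exact: E3.
- by rewrite -[RHS]E4 !addrA.
- by rewrite -[RHS]E5 !addrA.
by rewrite -[RHS]E6 !addrA.
Qed.

Lemma exists_unip a b e f d k : exists2 g,
  g \in unip_G2 & mx8 g = umx a b e f d k.
Proof.
have [g Eg] : exists g, mx8 g = umx a b e f d k.
  by exists (FinRing.Unit (umx_unit a b e f d k)).
by exists g => //; apply: mem_unip Eg.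
Qed.

Lemma unip_group_set : group_set unip_G2.
Proof.
apply/group_setP; split=> [|g h].
  by apply: (@mem_unip _ 0 0 0 0 0 0); rewrite umx0.
rewrite [g \in _]inE [h \in _]inE => /eqP Eg /eqP Eh.
by have := mx8M g h; rewrite Eg Eh umx_mul => /mem_unip.
Qed.
Canonical unip_group := Group unip_group_set.

Lemma mem_G2 g : (g \in G2 p) <->
  (forall x y : 'rV[F]_8, zorn_mul (x *m mx8 g) (y *m mx8 g) = zorn_mul x y *m
    mx8 g).
Proof.
rewrite inE; split=> [/forallP E x y|E];
  first by have /forallP/(_ y)/eqP := E x.
by apply/forallP=> x; apply/forallP=> y; apply/eqP; apply: E.
Qed.

Lemma unip_sub_G2 : unip_G2 \subset G2 p.
Proof.
apply/subsetP=> g; rewrite inE => /eqP Eg; apply/mem_G2=> x y.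
by rewrite Eg umx_zorn_mul.
Qed.


Lemma unip_eq g : g \in unip_G2 ->
  mx8 g = umx (umx_al g) (umx_be g) (umx_ga g) (umx_c g) (umx_d2 g) (umx_d3 g).
Proof. by rewrite inE => /eqP. Qed.

Lemma mx8_inj : injective mx8.
Proof. exact: val_inj. Qed.

(* Writing g = x(al) q with x(a) = umx a 0 0 0 0 0, these are the coordinates of
   q in Q2, with z modified by a quadratic form in w so that the cocycle becomes
   the invariant symplectic form. *)
Let w2 g := umx_c g + umx_ga g * umx_al g.
Let w3 g := umx_d2 g + w2 g * umx_al g.
Let z g := umx_be g * w3 g - umx_ga g * w2 g
  - (umx_d3 g - umx_ga g ^+ 2 * umx_al g + umx_be g * w2 g * umx_al g) *+ 2.

Lemma umx_paramsM g h : g \in unip_G2 -> h \in unip_G2 ->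
  let (al, al') := (umx_al g, umx_al h) in
  let (be, be') := (umx_be g, umx_be h) in
  let (ga, ga') := (umx_ga g, umx_ga h) in
  let (c, c') := (umx_c g, umx_c h) in
  let (d2, d2') := (umx_d2 g, umx_d2 h) in
  let (d3, d3') := (umx_d3 g, umx_d3 h) in
  [/\ [/\ umx_al (g * h)%g = al + al', umx_be (g * h)%g = be + be'
      & umx_ga (g * h)%g = ga + ga' + al' * be],
   umx_c (g * h)%g = (c + c' + al' * ga - al * ga' - al * al' * be),
   umx_d2 (g * h)%g = (d2 + d2' + al' * c *+ 2 - al * c' + al' ^+ 2 * ga - al *
     al' * ga'
     - al * al' ^+ 2 * be) &
   umx_d3 (g * h)%g = (d3 + d3' + be' * d2 + c' * ga - ga' * c *+ 2 + al' * be'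
     * c *+ 2
     - al' * ga * ga' - al * be' * c' - al * be * c' + al * ga' ^+ 2
     + al' ^+ 2 * be' * ga - al * al' * be' * ga' + al * al' * be * ga'
     - al * al' ^+ 2 * be * be')].
Proof.
by move=> /unip_eq Eg /unip_eq Eh; apply: umx_params;
  rewrite mx8M {1}Eg {1}Eh umx_mul.
Qed.

Hypothesis p_odd : (2 < p)%N.

Lemma unip_coords : G2_coords p [group of unip_G2].
Proof.
have two_neq0 : 2 != 0 :> F := (Fp_natr_neq0 (n := 2) p_pr p_odd).
refine (@G2Coords p _ _ umx_al umx_be umx_ga w2 w3 z _ _ _ _ _ _ _ _).
- by move=> g h /= Ug Uh; have [[-> _ _] _ _ _] := umx_paramsM Ug Uh.
- by move=> g h /= Ug Uh; have [[_ -> _] _ _ _] := umx_paramsM Ug Uh.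
- by move=> g h /= Ug Uh; have [[_ _ ->] _ _ _] := umx_paramsM Ug Uh; ring.
- by move=> g h /= Ug Uh; rewrite /w2;
  have [[-> _ ->] -> _ _] := umx_paramsM Ug Uh; ring.
- by move=> g h /= Ug Uh; rewrite /w3 /w2;
  have [[-> _ ->] -> -> _] := umx_paramsM Ug Uh; ring.
- move=> g h /= Ug Uh; rewrite /z /w3 /w2.
  by have [[-> -> ->] -> -> ->] := umx_paramsM Ug Uh; ring.
- move=> g h /= Ug Uh E1 E2 E3; rewrite /z /w3 /w2 E1 E2 E3 => E4.
  have {}E4 : umx_c g = umx_c h by apply: addIr E4.
  rewrite E4 => E5; have {}E5 : umx_d2 g = umx_d2 h by apply: addIr E5.
  rewrite E5 => E6; have {}E6 : umx_d3 g = umx_d3 h.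
    exact: double_subI two_neq0 E6.
  by apply: mx8_inj; rewrite (unip_eq Ug) (unip_eq Uh) E1 E2 E3 E4 E5 E6.
move=> t w0 w1 a2 a3 zz.
pose h : F := 2^-1.
have h2 : h * 2 = 1 by rewrite mulVf.
pose c := a2 - w1 * t; pose d2 := a3 - a2 * t.
pose D := (w0 * a3 - w1 * a2 - zz) * h.
have [g Ug Eg] := exists_unip t w0 w1 c d2 (D + w1 ^+ 2 * t - w0 * a2 * t).
exists g => //; have [[E1 E2 E3] E4 E5 E6] := umx_params Eg.
split; rewrite /z /w3 /w2 ?(E1, E2, E3, E4, E5, E6) /d2 /c //; try ring.
by rewrite -[RHS](half_solve (w0 * a3 - w1 * a2) zz h2) /D; ring.
Qed.


Lemma unip_pgroup : p.-group unip_G2.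
Proof. exact: S_pgroup unip_coords p_pr. Qed.

(* n preserves the flag <e1> < <e1, f3> < <e1, f3, f2>, each step of which
   consists of vectors fixed by U modulo the previous one; its eigenvalues there
   have p-power order in F_p. *)
Lemma norm_unip (n : GL8) N : n \in G2 p -> n \in 'N(unip_G2) -> (n ^+ (p ^ N)
  = 1)%g ->
  n \in unip_G2.
Proof.
move=> /mem_G2 nM nN n1.
(* With n u = v n, the displacement of x n by u is the image under n of the displacement of x by
   v. *)
have diffE u (x : 'rV[F]_8) : u \in unip_G2 -> exists a b e f d k,
    x *m mx8 n *m mx8 u - x *m mx8 n = (x *m umx a b e f d k - x) *m mx8 n.
  move=> /(mem_norm_comm nN)[v Uv E].
  exists (umx_al v), (umx_be v), (umx_ga v), (umx_c v), (umx_d2 v), (umx_d3 v).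
  by rewrite -(unip_eq Uv) mulmxBl -[x *m _ *m _]mulmxA -[x *m mx8 v *m
    _]mulmxA -!mx8M E.
have [xa Ua Ea] := exists_unip 1 0 0 0 0 0.
have [xb Ub Eb] := exists_unip 0 1 0 0 0 0.
(* W constrains the coordinates c at e1 and r at f3 of the displacements. By [umx_flag] c1 and r2
   become the f3 and f2 coordinates of the image of x, so each choice of W below places one more
   flag vector. *)
have flag (x : 'rV[F]_8) (W : F -> F -> Prop) : zorn_mul x x = 0 ->
    (forall a b e f d k, exists c r, W c r /\
       (x *m umx a b e f d k - x) *m mx8 n = zv 0 c 0 0 0 0 r 0) ->
    exists u0 c1 r1 c2 r2,
      [/\ x *m mx8 n = zv 0 u0 0 0 0 r2 c1 0, W c1 r1 & W c2 r2].
  move=> x0 Wx.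
  have [a1 [b1 [g1 [f1 [d1 [k1 D1]]]]]] := diffE xa x Ua.
  have [a2 [b2 [g2 [f2 [d2 [k2 D2]]]]]] := diffE xb x Ub.
  have [c1 [r1 [W1 E1]]] := Wx a1 b1 g1 f1 d1 k1.
  have [c2 [r2 [W2 E2]]] := Wx a2 b2 g2 f2 d2 k2.
  rewrite Ea E1 in D1; rewrite Eb E2 in D2.
  have [|u0 ->] := umx_flag D1 D2; first by rewrite nM x0 mul0mx.
  by exists u0, c1, r1, c2, r2.
have sq0 (u v1 v2 : F) : zorn_mul (zv 0 u 0 0 0 v1 v2 0) (zv 0 u 0 0 0 v1 v2 0)
  = 0.
  rewrite zorn_mulE; apply/rowP=> j; rewrite !mxE.
  by case: j => -[|[|[|[|[|[|[|[|[]]]]]]]]] //= _; ring.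
have [|l [c1 [r1 [c2 [r2 [E1 [c1E _] [_ r2E]]]]]]] :=
    flag (zv 0 1 0 0 0 0 0 0) (fun c r => c = 0 /\ r = 0) (sq0 _ _ _).
  move=> a b e f d k; exists 0, 0; split=> //; rewrite zv_umx.
  rewrite (_ : zv _ _ _ _ _ _ _ _ - _ = 0) ?mul0mx.
    by apply/rowP=> j; rewrite !mxE; case: j => -[|[|[|[|[|[|[|[|[]]]]]]]]].
  by apply/eqP; rewrite subr_eq0; apply/eqP; congr zv; ring.
rewrite c1E r2E in E1; clear c1 r1 c2 r2 c1E r2E.
have zvZ1 (a b : F) : zv 0 a 0 0 0 0 b 0 = a *: zv 0 1 0 0 0 0 0 0 + b *: zv 0
  0 0 0 0 0 1 0.
  by rewrite !zvZ zvD; congr zv; ring.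
have [|x [m [r1 [c2 [r2 [E3 _ r2E]]]]]] :=
    flag (zv 0 0 0 0 0 0 1 0) (fun c r => r = 0) (sq0 _ _ _).
  move=> a b e f d k; exists (a * l), 0; split=> //.
  rewrite zv_umx (_ : zv _ _ _ _ _ _ _ _ - _ = a *: zv 0 1 0 0 0 0 0 0).
    by rewrite -scalemxAl E1 zvZ; congr zv; ring.
  by apply/eqP; rewrite subr_eq zvZ zvD; apply/eqP; congr zv; ring.
rewrite r2E in E3; clear r1 c2 r2 r2E.
have [|y [w [r1 [c2 [k [E2 _ _]]]]]] :=
    flag (zv 0 0 0 0 0 1 0 0) (fun c r => True) (sq0 _ _ _).
  move=> a b e f d k; exists (e * l + b * x), (b * m); split=> //.
  rewrite zv_umx (_ : zv _ _ _ _ _ _ _ _ - _ = zv 0 e 0 0 0 0 b 0).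
    by rewrite zvZ1 mulmxDl -!scalemxAl E1 E3 !zvZ zvD; congr zv; ring.
  by apply/eqP; rewrite subr_eq zvD; apply/eqP; congr zv; ring.
have nX N' : mx8 (n ^+ N')%g = mx8 n ^+ N' :> 'M[F]_8.
  elim: N' => [|N' IH]; first by rewrite expr0.
  by rewrite expgS exprS -IH.
have nN1 : mx8 n ^+ (p ^ N) = 1%:M by rewrite -nX n1.
have [l1 m1 k1] := flag_expmx E1 E3 E2 nN1.
(* In F_p the p-th power map is the identity, so u equals its own p^N-th power. *)
have fixN (u : F) : u ^+ (p ^ N) = 1 -> u = 1.
  move=> <-; elim: (N) => [|N' IH]; first by rewrite expn0 expr1.
  by rewrite expnS mulnC exprM -IH -[X in _ ^+ X](card_Fp p_pr) expf_card.
rewrite (fixN l l1) (fixN m m1) (fixN k k1) in E1 E2 E3.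
by have [f [d2 [d3 /mem_unip]]] := umx_eq nM E1 E3 E2.
Qed.

Lemma unip_Sylow : p.-Sylow(G2 p) unip_G2.
Proof. exact: (Sylow_norm_sub unip_sub_G2 unip_pgroup norm_unip). Qed.

Lemma Sylow_coords (S : {group GL8}) : p.-Sylow(G2 p) S -> inhabited (G2_coords
  p S).
Proof.
move=> sylS; have [x _ defS] := Sylow_trans unip_Sylow sylS.
by constructor; apply: coords_conj unip_coords defS.
Qed.

End Unipotent.

(** * Fusion *)

Section Fusion.

Variables (gT : finGroupType) (S : {group gT}) (F : fusion_system S).
Implicit Types (P R L K H : {group gT}) (f g : gT -> gT).

Lemma inv_onK P f x : {in P &, injective f} -> x \in P -> inv_on P f (f x) = x.
Proof.
move=> injf Px; rewrite /inv_on; case: pickP => [y /andP[Py /eqP/injf->] //|].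
by move/(_ x); rewrite Px eqxx.
Qed.

Lemma fiso_props P R f : fiso F P R f ->
  [/\ {in P &, {morph f : x y / x * y}}, {in P &, injective f}, f @: P = R,
      P \subset S & R \subset S].
Proof.
case/andP=> Ff /eqP fP; have [fM injf _] := fhom_inj Ff.
by have [sPS sRS] := fhom_sub Ff.
Qed.

Lemma inv_onKV P R f y : fiso F P R f -> y \in R -> f (inv_on P f y) = y.
Proof.
by case/fiso_props=> _ injf <- _ _ /imsetP[x Px ->]; rewrite inv_onK.
Qed.

Lemma fiso_mem P R f x : fiso F P R f -> x \in P -> f x \in R.
Proof. by case/fiso_props=> _ _ <- _ _ Px; rewrite imset_f. Qed.

Lemma fiso_sym P R f : fiso F P R f -> fiso F R P (inv_on P f).
Proof.
move=> isof; have [_ injf fP _ _] := fiso_props isof; have /andP[Ff _] := isof.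
have [_ Fi] := fhom_iso Ff (esym fP); rewrite /fiso Fi /=.
apply/eqP/setP=> x; apply/imsetP/idP=> [[y] | Px].
  by rewrite -fP => /imsetP[z Pz ->] ->; rewrite inv_onK.
by exists (f x); rewrite ?inv_onK // -fP imset_f.
Qed.

Lemma fiso_comp P R L f g : fiso F P R f -> fiso F R L g -> fiso F P L (g \o f).
Proof.
case/andP=> Ff /eqP fP /andP[Fg /eqP gR].
by rewrite /fiso (fhom_comp Ff Fg) imset_comp fP gR eqxx.
Qed.

Lemma fiso_ext P R f g : {in P, f =1 g} -> fiso F P R f -> fiso F P R g.
Proof.
move=> Efg /andP[Ff /eqP fP]; rewrite /fiso (fhom_ext Efg Ff) -fP.
by apply/eqP/esym/eq_in_imset.
Qed.

Lemma fiso_conj P x : P \subset S -> x \in S -> fiso F P (P :^ x^-1)%G (lconj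
  x).
Proof.
move=> sPS Sx; have E : lconj x @: P = P :^ x^-1.
  rewrite /conjugate; apply: eq_imset => y.
  by rewrite /lconj conjgE invgK mulgA.
rewrite /fiso E eqxx andbT; apply: fhom_conj => //; last by rewrite E.
by rewrite -(conjGid (groupVr Sx)) conjSg.
Qed.

Lemma fconjP P R : reflect (exists f, fiso F P R f) (fconj F P R).
Proof.
apply: (iffP existsP) => [[f isof]|[f isof]]; first by exists f.
by exists (finfun f); apply: fiso_ext isof => x _; rewrite ffunE.
Qed.

Lemma fconj_refl P : P \subset S -> fconj F P P.
Proof.
move=> sPS; apply/fconjP; exists (lconj 1).
suff E : (P :^ 1^-1)%G = P by rewrite -{2}E fiso_conj.
by apply: val_inj; rewrite /= invg1 conjsg1.
Qed.

Lemma fconj_sym P R : fconj F P R -> fconj F R P.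
Proof. by case/fconjP=> f /fiso_sym isof; apply/fconjP;
  exists (inv_on P f). Qed.

Lemma fconj_trans P R L : fconj F P R -> fconj F R L -> fconj F P L.
Proof.
by case/fconjP=> f isof /fconjP[g isog]; apply/fconjP; exists (g \o f);
  apply: fiso_comp isog.
Qed.

Lemma fhom_res P R K f : K \subset P -> F P R f ->
  exists L, [/\ L :=: f @: K & fiso F K L f].
Proof.
move=> sKP Ff; have [sPS sRS] := fhom_sub Ff; have [fM _ _] := fhom_inj Ff.
have FK : F K R f.
  have FKP : F K P (lconj 1).
    apply: fhom_conj => //; first exact: subset_trans sPS.
    by apply/subsetP=> _ /imsetP[x Kx ->];
      rewrite /lconj mul1g invg1 mulg1 (subsetP sKP).
  by apply: fhom_ext (fhom_comp FKP Ff) => x _;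
    rewrite /= /lconj mul1g invg1 mulg1.
have gK : group_set (f @: K).
  apply/group_setP; split.
    suff <- : f 1 = 1 by rewrite imset_f.
    by apply: (mulgI (f 1)); rewrite -fM ?(subsetP sKP) // !mulg1.
  move=> _ _ /imsetP[x Kx ->] /imsetP[y Ky ->].
  by rewrite -fM ?(subsetP sKP) // imset_f ?groupM.
exists (Group gK); split=> //; rewrite /fiso eqxx andbT.
by have [] := fhom_iso FK (erefl : Group gK :=: f @: K).
Qed.

Lemma centric_cent P : P \subset S -> centric F P -> 'C_S(P) \subset P.
Proof. by move=> sPS /forallP/(_ P)/implyP; apply; apply: fconj_refl. Qed.

(** An isomorphism from L to M restricts to K, so M contains an F-conjugate N of K, and C_S(M) <=
    C_S(N) <= N <= M. *)
Lemma centric_sub K L : K \subset L -> L \subset S -> centric F K -> centric F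
  L.
Proof.
move=> sKL sLS /forallP cK; apply/forallP=> M; apply/implyP=> /fconjP[f isof].
have /andP[Ff /eqP fL] := isof; have [N [NE isoN]] := fhom_res sKL Ff.
have sNM : N \subset M by rewrite NE -fL imsetS.
have := implyP (cK N) (introT (fconjP _ _) (ex_intro _ f isoN)) => cN.
by apply: subset_trans (subset_trans cN sNM); rewrite setIS ?centS.
Qed.

Lemma fconj_centric K L : fconj F K L -> centric F K -> centric F L.
Proof.
move=> cKL /forallP cK; apply/forallP=> M; apply/implyP=> cLM.
exact: (implyP (cK M)) (fconj_trans cKL cLM).
Qed.

Lemma card_fiso P R f : fiso F P R f -> #|R| = #|P|.
Proof. by case/fiso_props=> _ injf <- _ _; rewrite card_in_imset. Qed.

Lemma card_fiso_cent1 P R f x : fiso F P R f -> x \in P ->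
  #|'C_R[f x]| = #|'C_P[x]|.
Proof.
move=> isof Px; have [fM injf fP _ _] := fiso_props isof.
rewrite -(card_in_imset (f := f) (D := 'C_P[x])); last first.
  by move=> y z /setIP[Py _] /setIP[Pz _]; apply: injf.
congr #|pred_of_set _|; apply/setP=> y;
  apply/setIP/imsetP=> [[]|[z /setIP[Pz cz] ->]].
  rewrite -fP => /imsetP[z Pz ->] /cent1P cz; exists z => //.
  rewrite inE Pz; apply/cent1P/injf; rewrite ?groupM //.
  by rewrite !fM.
split; first by rewrite -fP imset_f.
by apply/cent1P; rewrite /commute -!fM // (cent1P cz).
Qed.

Lemma fiso_abelian P R f : fiso F P R f -> abelian P -> abelian R.
Proof.
move=> isof /centsP cP; have [fM _ fP _ _] := fiso_props isof.
rewrite -fP; apply/centsP=> _ /imsetP[x Px ->] _ /imsetP[y Py ->].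
by rewrite /commute -!fM // cP.
Qed.

Lemma to_autE P f (a : {perm gT}) : a \in Aut P -> {in P,
  a =1 f} -> to_aut P f = a.
Proof.
move=> Aa Ea; rewrite /to_aut;
  case: pickP => [b /andP[Ab /forall_inP Eb]|/(_ a)] /=.
  by apply: (eq_Aut Ab Aa) => x Px; rewrite (eqP (Eb x Px)) Ea.
by rewrite Aa; case/forall_inP=> x Px; rewrite Ea.
Qed.

Lemma fiso_to_aut P f : fiso F P P f ->
  to_aut P f \in AutF F P /\ {in P, to_aut P f =1 f}.
Proof.
move=> isof; have [fM injf fP sPS _] := fiso_props isof.
have sfP : f @: P \subset P by rewrite fP.
pose a := perm_in injf sfP.
have Ea : {in P, a =1 f} by move=> x Px; rewrite perm_inE.
have Aa : a \in Aut P.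
  rewrite inE perm_in_on; apply/morphicP=> x y Px Py.
  by rewrite !Ea ?groupM // fM.
rewrite (to_autE Aa Ea); split=> //; rewrite inE Aa sPS /=.
by have /andP[Ff _] := isof; apply: fhom_ext Ff => x Px; rewrite Ea.
Qed.

Section AutOf.

Variables (K H : {group gT}) (f : gT -> gT).
Hypothesis isof : fiso F K H f.

(* x |-> th x reverses products, since {perm gT} composes left to right. *)
Let th x := to_aut H (f \o lconj x \o inv_on K f).

Lemma fiso_norm_conj x : x \in 'N_S(K) -> fiso F K K (lconj x).
Proof.
case/setIP=> Sx nKx; have [_ _ _ sKS _] := fiso_props isof.
have := fiso_conj sKS Sx; suff -> : (K :^ x^-1)%G = K by [].
by apply/val_inj/normP; rewrite groupV.
Qed.

Lemma norm_to_autE x : x \in 'N_S(K) -> th x \in AutF F H /\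
  {in H, th x =1 f \o lconj x \o inv_on K f}.
Proof.
move=> Nx; apply: fiso_to_aut; apply: fiso_comp (fiso_sym isof) _.
exact: fiso_comp (fiso_norm_conj Nx) isof.
Qed.

Lemma norm_to_autM : {in 'N_S(K) &, {morph (fun x => th x^-1) : x y / x * y}}.
Proof.
move=> x y Nx Ny /=; have [NVx NVy] := (groupVr Nx, groupVr Ny).
have [Tx Ex] := norm_to_autE NVx; have [Ty Ey] := norm_to_autE NVy.
rewrite invMg /th; apply: to_autE.
  by rewrite groupM //; [case/setIdP: Tx | case/setIdP: Ty].
have [_ injf _ _ _] := fiso_props isof.
move=> h Hh /=; have Kh := fiso_mem (fiso_sym isof) Hh.
have Kxh := fiso_mem (fiso_norm_conj NVx) Kh.
rewrite permM Ex //= Ey ?(fiso_mem isof) //= (inv_onK injf) //.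
by rewrite /lconj !invMg !invgK !mulgA.
Qed.

End AutOf.

(** The action of N_S(K) carried to H by f is a p-group, so some a in Aut_F(H) conjugates it into
    the Sylow subgroup Aut_S(H). The extension domain of [a \o f] is then all of N_S(K), and
    receptivity extends this map. *)
Lemma extend_normalizer (p : nat) H K : p.-group S -> fully_automised F p H ->
  receptive F H -> fconj F K H -> exists2 g, F 'N_S(K)%G S g & g @: K = H.
Proof.
move=> pS sylH recH /fconjP[f isof].
pose tau := Morphism (norm_to_autM isof).
have pA : p.-group (tau @* 'N_S(K)).
  by rewrite morphim_pgroup // (pgroupS _ pS) ?subsetIl.
have sAF : tau @* 'N_S(K) \subset AutF F H.
  apply/subsetP=> _ /morphimP[x _ Nx ->].
  by have [] := norm_to_autE isof (groupVr Nx).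
have [a Fa sAa] := Sylow_Jsub sylH sAF pA.
have [Aa FHa] := setIdP Fa.
have [_ _ fK sKS sHS] := fiso_props isof; rewrite sHS /= in FHa.
have isoa : fiso F H H a.
  rewrite /fiso FHa eqEcard card_imset ?leqnn ?andbT; last exact: perm_inj.
  by apply/subsetP=> _ /imsetP[x Hx ->]; apply: Aut_closed Aa _ Hx.
have isoc := fiso_comp isof isoa.
have defN : ext_dom S K H (a \o f) = 'N_S(K).
  apply/setP=> x; rewrite inE andb_idr // => Nx.
  apply: (subsetP sAa); rewrite mem_conjg.
  have -> : to_aut H ((a \o f) \o lconj x \o inv_on K (a \o f)) =
      to_aut H (f \o lconj x \o inv_on K f) ^ a.
    apply: to_autE; first by have [/setIdP[Tx _] _] := norm_to_autE isof Nx;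
      rewrite groupJ.
    move=> h Hh; have [_ E] := norm_to_autE isof Nx;
      have [_ injf _ _ _] := fiso_props isof.
    have Ha : a^-1 h \in H by rewrite (Aut_closed (groupVr Aa)).
    rewrite conjgE !permM E //=; congr (a (f (lconj x _))).
    rewrite -{2}(permKV a h) -{2}(inv_onKV isof Ha).
    have [_ injc _ _ _] := fiso_props isoc.
    by rewrite -[a (f _)]/((a \o f) _) (inv_onK injc) // (fiso_mem (fiso_sym
      isof)).
  rewrite conjgK; apply/morphimP; exists x^-1; rewrite ?groupV //=.
  by rewrite invgK.
have [g Fg Eg] := recH _ _ isoc.
exists g; last first.
  by have [_ _ <- _ _] := fiso_props isoc; apply/esym/eq_in_imset.
suff <- : <<ext_dom S K H (a \o f)>>%G = 'N_S(K)%G by [].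
by apply: val_inj; rewrite /= defN genGid.
Qed.

End Fusion.

(** * Invariance of good subgroups under fusion *)

Section GoodFusion.

Variables (p : nat) (gT : finGroupType) (S : {group gT}).
Variables (F : fusion_system S) (C : G2_coords p S).
Hypotheses (p_pr : prime p) (p_ge5 : (5 <= p)%N) (satF : saturated F p).
Implicit Types (K H N L A : {group gT}).

(** The centralizer of n in N has order at most p^2, and f carries this to [f n] in L. A good
    element of L is required because only then does [not_good_cent_ge] apply in L. *)
Lemma good_fiso N L f n g : fiso F N L f -> (p ^ 4 <= #|N|)%N ->
  g \in L -> good C g -> n \in N -> good C n -> good C (f n).
Proof.
move=> isof leN Lg gg Nn gn; have [_ _ _ sNS sLS] := fiso_props isof.
apply: contraLR (good_cent_le p_pr p_ge5 sNS gn) => ngfn.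
rewrite -ltnNge -(card_fiso_cent1 isof Nn).
apply: leq_trans (not_good_cent_ge p_pr p_ge5 sLS gg Lg _ (fiso_mem isof Nn)
  ngfn).
  by rewrite ltn_exp2l ?(prime_gt1 p_pr).
by rewrite (card_fiso isof).
Qed.

(* Good elements of a good subgroup of order at least p^4 are recognised by the
   order of their centralizers, so isomorphisms between normalizers, which are
   larger and good by induction, preserve them. *)
Lemma good_fconj K g H : K \subset S -> g \in K -> good C g ->
  (p ^ 3 <= #|K|)%N -> fconj F K H -> exists2 h, h \in H & good C h.
Proof.
have [m] := ubnP (#|S| - #|K|)%N; elim: m => // m IH in K g H *.
move=> ltm sKS Kg gg leK cKH; have /fconjP[f isof] := cKH.
have [_ _ _ _ sHS] := fiso_props isof.
have [eKS|ltKS] := leqP #|S| #|K|.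
  exists g => //; suff -> : H = K by [].
  apply/val_inj/eqP; rewrite eqEcard (card_fiso isof) leqnn andbT.
  have /= -> // : K = S by apply/val_inj/eqP; rewrite eqEcard sKS.
have norm_gt L : L \subset S -> #|L| = #|K| -> (#|L| < #|'N_S(L)|)%N.
  move=> sLS cL; apply/proper_card/nilpotent_proper_norm.
    exact: pgroup_nil (S_pgroup C p_pr).
  by rewrite properEcard sLS cL.
have ltN L : (#|K| < #|L|)%N -> (#|S| - #|L| < m)%N.
  by move=> ltKL; rewrite -ltnS (leq_trans _ ltm) // ltnS ltn_sub2l.
have le4 L : L \subset S -> (#|K| < #|L|)%N -> (p ^ 4 <= #|L|)%N.
  by move=> sLS ltKL; rewrite (leq_card_p C p_pr) // (leq_ltn_trans leK).
have le3 L : L \subset S -> (#|K| < #|L|)%N -> (p ^ 3 <= #|L|)%N.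
  by move=> sLS ltKL; rewrite (leq_trans leK) // ltnW.
have sNS L : ('N_S(L))%G \subset S by apply: subsetIl.
have sLN L : L \subset S -> L \subset ('N_S(L))%G.
  by move=> sLS; rewrite subsetI sLS normG.
have [H0 [cKH0 sylH0 recH0]] := satF sKS.
have ext L : L \subset S -> #|L| = #|K| -> fconj F L H0 ->
    exists N g0, [/\ fiso F ('N_S(L))%G N g0, g0 @: L = H0 & (#|K| < #|N|)%N].
  move=> sLS cL cLH0.
  have [g0 Fg0 g0L] := extend_normalizer (S_pgroup C p_pr) sylH0 recH0 cLH0.
  have [N [_ isog0]] := fhom_res (subxx _) Fg0.
  exists N, g0; split=> //.
  by rewrite (card_fiso isog0) -cL norm_gt.
have [N [g0 [isog0 g0K ltKN]]] := ext K sKS erefl cKH0.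
have [_ _ _ _ sNS'] := fiso_props isog0.
have ltKNK := norm_gt K sKS erefl.
(* The induction hypothesis for N_S(K) supplies the good element of N that [good_fiso] asks for. *)
have [h0 Nh0 gh0] : exists2 h0, h0 \in N & good C h0.
  apply: (IH 'N_S(K)%G g N) => //;
    [exact: ltN | exact: (subsetP (sLN K sKS)) | exact: le3 | ].
  by apply/fconjP; exists g0.
have H0g : g0 g \in H0 by rewrite -g0K imset_f.
have gg0 : good C (g0 g).
  by apply: (good_fiso isog0 _ Nh0 gh0) => //;
    [exact: le4 | exact: (subsetP (sLN K sKS))].
have cH : #|H| = #|K| := card_fiso isof.
(* K and H are compared through the receptive conjugate H0: the good element [g0 g] of H0 is pulled
   back to H along an extension g1 defined on N_S(H). *)
have [L [g1 [isog1 g1H ltKL]]] :=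
  ext H sHS cH (fconj_trans (fconj_sym cKH) cKH0).
have [_ inj1 _ _ sLS] := fiso_props isog1.
have /imsetP[h Hh Eh] : g0 g \in g1 @: H by rewrite g1H.
have NHh : h \in 'N_S(H)%G by apply: (subsetP (sLN H sHS)).
have Lh : g0 g \in L by rewrite Eh (fiso_mem isog1).
have [h1 Nh1 gh1] : exists2 h1, h1 \in 'N_S(H)%G & good C h1.
  apply: (IH L (g0 g)) => //; [exact: ltN | exact: le3 |].
  by apply/fconj_sym/fconjP; exists g1.
exists h => //; rewrite -(inv_onK inj1 NHh) -Eh.
by apply: (good_fiso (fiso_sym isog1) _ Nh1 gh1) => //; apply: le4.
Qed.

Lemma good_F_centric K g : K \subset S -> good C g -> g \in K ->
  (p ^ 3 <= #|K|)%N -> centric F K.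
Proof.
move=> sKS gg Kg leK; apply/forallP=> H; apply/implyP=> cKH.
have [h Hh gh] := good_fconj sKS Kg gg leK cKH.
have /fconjP[f isof] := cKH; have [_ _ _ _ sHS] := fiso_props isof.
by apply: (good_centric p_pr p_ge5 sHS gh Hh); rewrite (card_fiso isof).
Qed.

Lemma abelian_F_centric K A : K \subset S -> A \subset K -> abelian A ->
  (p ^ 3 <= #|A|)%N -> centric F K.
Proof.
move=> sKS sAK cAA leA.
apply: (centric_sub sAK sKS); apply/forallP=> B; apply/implyP=> /fconjP[f isof].
have [_ _ _ _ sBS] := fiso_props isof.
apply: (abelian_self_centralizing C p_pr p_ge5 sBS (fiso_abelian isof cAA)).
by rewrite (card_fiso isof).
Qed.

End GoodFusion.

(** * Relative traces *)

Section Traces.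

Variables (gT : finGroupType) (S : {group gT}) (F : fusion_system S).
Variables (p : nat) (Q : {group gT}) (n : nat).
Variable rV : mx_representation 'F_p (OutF F Q) n.
Variable alpha : {group gT} -> gT -> gT.
Hypothesis isoa : forall L, fconj F Q L -> fiso F Q L (alpha L).
Local Notation V := 'rV['F_p]_n.
Implicit Types (L M N H K P R : {group gT}) (f g : gT -> gT) (v w : V).

Lemma AutF_norm_Inn (P : {group gT}) : AutF F P \subset 'N(Inn P).
Proof.
apply/subsetP=> a /setIdP[Aa _]; rewrite inE; apply/subsetP=> _ /imsetP[b + ->].
case/morphimP=> x nPx Px ->; apply/morphimP.
have Pax : a x \in P by apply: Aut_closed.
exists (a x); rewrite ?(subsetP (normG P)) //.
apply: (eq_Aut (A := P)).
- by rewrite groupJ // (subsetP (Aut_conj_aut _ P)) // mem_morphim.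
- by rewrite (subsetP (Aut_conj_aut _ P)) // mem_morphim // (subsetP (normG P)).
move=> y Py; rewrite conjgE !permM.
have Pay : a^-1 y \in P by rewrite (Aut_closed (groupVr Aa)).
rewrite !norm_conj_autE ?(subsetP (normG P)) //.
have aM := morphicP (Aut_morphic Aa).
have aV z : z \in P -> a z^-1 = (a z)^-1.
  move=> Pz; apply: (mulgI (a z)); rewrite -aM ?groupV // !mulgV.
  by apply: (mulgI (a 1)); rewrite -aM // !mulg1.
by rewrite !conjgE !aM ?groupM ?groupV // aV // permKV.
Qed.

Lemma out_act_ext f g v : {in Q, f =1 g} -> fiso F Q Q f -> 
  out_act rV f v = out_act rV g v.
Proof.
move=> Efg isof; rewrite /out_act.
have [Tf Ef] := fiso_to_aut isof; have /setIdP[Af _] := Tf.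
rewrite (to_autE (f := g) Af) // => x Qx.
by rewrite Ef // Efg.
Qed.

Lemma out_act_comp f g v : fiso F Q Q f -> fiso F Q Q g ->
  out_act rV (g \o f) v = out_act rV g (out_act rV f v).
Proof.
move=> isof isog; have [Tf Ef] := fiso_to_aut isof;
  have [Tg Eg] := fiso_to_aut isog.
rewrite /out_act (to_autE (a := to_aut Q f * to_aut Q g)).
- rewrite morphM ?(subsetP (AutF_norm_Inn Q)) // repr_mxM ?mem_quotient //.
  by rewrite mulmxA.
- by rewrite groupM //; [case/setIdP: Tf | case/setIdP: Tg].
by move=> x Qx; rewrite permM Ef // Eg // (fiso_mem isof).
Qed.

Lemma out_act_inner x v : x \in Q -> out_act rV (lconj x) v = v.
Proof.
move=> Qx; have NQ y : y \in Q -> y \in 'N(Q) by apply: (subsetP (normG Q)).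
(* The inverse appears because [conj_aut] conjugates on the right and [lconj] on the left. *)
have AC : conj_aut Q x^-1 \in Inn Q by rewrite mem_morphim ?NQ ?groupV.
rewrite /out_act (to_autE (a := conj_aut Q x^-1)).
- by rewrite coset_id // repr_mx1 mulmx1.
- by rewrite (subsetP (Aut_conj_aut _ Q)) // mem_morphim ?NQ ?groupV.
by move=> y Qy; rewrite norm_conj_autE ?NQ ?groupV // /lconj conjgE invgK mulgA.
Qed.

Lemma fiso_Iso L M f : fconj F Q L -> fiso F L M f ->
  fiso F Q Q (inv_on Q (alpha M) \o f \o alpha L).
Proof.
move=> cQL isof; have cQM : fconj F Q M.
  by apply: (fconj_trans cQL); apply/fconjP; exists f.
exact: (fiso_comp (isoa cQL) (fiso_comp isof (fiso_sym (isoa cQM)))).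
Qed.

Lemma Iso_comp L M N f g v : fconj F Q L -> fiso F L M f -> fiso F M N g ->
  Iso rV alpha M N g (Iso rV alpha L M f v) = Iso rV alpha L N (g \o f) v.
Proof.
move=> cQL isof isog; have cQM : fconj F Q M.
  by apply: (fconj_trans cQL); apply/fconjP; exists f.
rewrite /Iso -out_act_comp; last exact: fiso_Iso; last exact: fiso_Iso.
apply: out_act_ext; last by apply: fiso_comp; apply: fiso_Iso; eassumption.
move=> x Qx /=; congr (inv_on _ _ (g _)); rewrite (inv_onKV (isoa cQM)) //.
by rewrite (fiso_mem isof) // (fiso_mem (isoa cQL)).
Qed.

Lemma Iso_ext L M f g v : fconj F Q L -> fiso F L M f -> {in L, f =1 g} ->
  Iso rV alpha L M f v = Iso rV alpha L M g v.
Proof.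
move=> cQL isof Efg; apply: out_act_ext; last exact: fiso_Iso.
by move=> x Qx /=; rewrite Efg // (fiso_mem (isoa cQL)).
Qed.

Lemma Iso_sum L M f (I : finType) (A : pred I) (v : I -> V) :
  Iso rV alpha L M f (\sum_(i | A i) v i)%R = (\sum_(i | A i) Iso rV alpha L M
    f (v i))%R.
Proof. by rewrite /Iso /out_act mulmx_suml. Qed.

Lemma Iso0 L M f : Iso rV alpha L M f 0%R = 0%R.
Proof. by rewrite /Iso /out_act mul0mx. Qed.

Lemma fiso_norm L x : fconj F Q L -> x \in 'N_S(L) -> fiso F L L (lconj x).
Proof. by move=> /isoa isoL; apply: (fiso_norm_conj (fiso_sym isoL)). Qed.

Lemma lconjM x y : lconj (x * y) =1 lconj x \o lconj y :> (gT -> gT).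
Proof. by move=> z; rewrite /lconj /= invMg !mulgA. Qed.

Lemma act_onM L x y v : fconj F Q L -> x \in 'N_S(L) -> y \in 'N_S(L) ->
  act_on rV alpha L (x * y) v = act_on rV alpha L x (act_on rV alpha L y v).
Proof.
move=> cQL Nx Ny; rewrite -[RHS]/(Iso rV alpha L L (lconj x) (Iso rV alpha L L
  (lconj y) v)).
rewrite Iso_comp ?fiso_norm //.
by apply: Iso_ext; rewrite ?fiso_norm ?groupM // => z _; rewrite lconjM.
Qed.

Lemma act_on_cent L x v : fconj F Q L -> x \in 'C_S(L) -> act_on rV alpha L x v
  = v.
Proof.
move=> cQL /setIP[Sx cLx].
have isox : fiso F L L (lconj x).
  by apply: fiso_norm; rewrite // inE Sx (subsetP (cent_sub L)).
rewrite -[RHS](out_act_inner v (group1 Q)); apply: out_act_ext;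
  last exact: fiso_Iso.
move=> y Qy; have isoL := isoa cQL; have [_ injL _ _ _] := fiso_props isoL.
have Ly := fiso_mem isoL Qy.
rewrite /= {1}/lconj (centP cLx) // mulgK inv_onK //.
by rewrite /lconj mul1g invg1 mulg1.
Qed.

Lemma act_on_inner L x v : fconj F Q L -> x \in L -> act_on rV alpha L x v = v.
Proof.
move=> cQL Lx; have isoL := isoa cQL;
  have [aM injL aQ _ sLS] := fiso_props isoL.
have isox : fiso F L L (lconj x).
  by apply: fiso_norm; rewrite // inE (subsetP sLS) // (subsetP (normG L)).
have Qx := fiso_mem (fiso_sym isoL) Lx; set y := inv_on Q (alpha L) x in Qx.
rewrite -[RHS](out_act_inner v Qx); apply: out_act_ext; last exact: fiso_Iso.
move=> z Qz; rewrite /= -[RHS](inv_onK injL);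
  last by rewrite /lconj !groupM ?groupV.
congr (inv_on _ _ _); have ay : alpha L y = x by rewrite (inv_onKV isoL).
have a1 : alpha L 1 = 1 by apply: (mulgI (alpha L 1)); rewrite -aM // !mulg1.
have aV : alpha L y^-1 = x^-1.
  by apply: (mulgI x); rewrite -{1}ay -aM ?groupV // !mulgV.
by rewrite /lconj !aM ?groupM ?groupV // ay aV.
Qed.

Lemma act_on_gen L (A : {set gT}) v : fconj F Q L -> A \subset 'N_S(L) ->
    {in A, forall x, act_on rV alpha L x v = v} ->
  {in <<A>>, forall x, act_on rV alpha L x v = v}.
Proof.
move=> cQL sAN fixA.
have gU : group_set [set x in 'N_S(L) | act_on rV alpha L x v == v].
  apply/group_setP; split=> [|x y /setIdP[Nx /eqP fx] /setIdP[Ny /eqP fy]].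
    by rewrite inE group1 act_on_inner ?eqxx.
  by rewrite inE groupM //= act_onM // fy fx.
suff /subsetP sAU : <<A>> \subset Group gU.
  by move=> x /sAU/setIdP[_ /eqP].
rewrite gen_subG; apply/subsetP=> x Ax.
by rewrite inE (subsetP sAN) //= fixA.
Qed.

Lemma rtrace_fixed L H N v y : fconj F Q L -> N \subset 'N_S(L) ->
    H \subset N -> (forall x, x \in H -> act_on rV alpha L x v = v) -> y \in N
      ->
  act_on rV alpha L y (rtrace rV alpha L H N v) = rtrace rV alpha L H N v.
Proof.
move=> cQL sNN sHN fixv Ny;
  have NN x : x \in N -> x \in 'N_S(L) by apply: (subsetP sNN).
have reprN c : c \in lcosets H N -> repr c \in N /\ c = repr c *: H.
  case/lcosetsP=> x Nx ->; have := mem_repr x (lcoset_refl H x).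
  move=> rx; split; last by apply/esym/lcoset_eqP.
  by case/lcosetP: rx => h /(subsetP sHN) Nh ->; rewrite groupM.
rewrite -[LHS]/(Iso rV alpha L L (lconj y) (\sum_(c in lcosets H N) _)%R)
  Iso_sum.
rewrite [RHS](reindex_inj (@lcoset_inj gT y)) /=.
apply: eq_big => [c|c Hc].
  apply/idP/idP => [/lcosetsP[x Nx ->]|].
    by apply/lcosetsP; exists (y * x); rewrite ?groupM // lcosetM.
  case/lcosetsP=> x Nx E; apply/lcosetsP; exists (y^-1 * x).
    by rewrite groupM ?groupV.
  by rewrite lcosetM -E lcosetK.
have [Nc Ec] := reprN c Hc.
rewrite -[LHS]/(act_on rV alpha L y (act_on rV alpha L (repr c) v)) -act_onM
  ?NN //.
(* Left multiplication by y permutes the cosets; the representative of y c and y times that of c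
   differ by a right factor in H, which fixes v. *)
have : repr (y *: c) \in y *: c.
  by apply: (mem_repr (y * repr c)); rewrite mem_lcoset mulKg {2}Ec lcoset_refl.
rewrite {2}Ec -lcosetM => /lcosetP[h Hh ->].
have Nh := subsetP sHN h Hh.
by rewrite [RHS]act_onM ?(fixv h Hh) // NN // groupM.
Qed.

(* Grouping the H-cosets by K-cosets, each summand occurs |K : H| times. *)
Lemma rtrace_eq0 L H K N v : prime p -> p.-group N -> fconj F Q L ->
    N \subset 'N_S(L) -> H \proper K -> K \subset N ->
    (forall x, x \in K -> act_on rV alpha L x v = v) ->
  rtrace rV alpha L H N v = 0%R.
Proof.
move=> p_pr pN cQL sNN pHK sKN fixv.
have NN x : x \in N -> x \in 'N_S(L) by apply: (subsetP sNN).
have sHK := proper_sub pHK; have sHN := subset_trans sHK sKN.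
have reprN (B : {group gT}) c : B \subset N -> c \in lcosets B N -> repr c \in
  N /\ c = repr c *: B.
  move=> sBN /lcosetsP[x Nx ->]; have := mem_repr x (lcoset_refl B x).
  move=> rx; split; last by apply/esym/lcoset_eqP.
  by case/lcosetP: rx => h /(subsetP sBN) Nh ->; rewrite groupM.
rewrite /rtrace (partition_big (fun c => c * K) (mem (lcosets K N))) /=;
  last first.
  move=> c /lcosetsP[x Nx ->]; apply/lcosetsP; exists x => //.
  by rewrite -mulgA mulSGid.
apply: big1 => d Kd.
have [Nd Ed] := reprN K d sKN Kd.
rewrite (eq_bigr (fun=> act_on rV alpha L (repr d) v)); last first.
  move=> c /andP[Hc /eqP cK]; have [Nc Ec] := reprN H c sHN Hc.
  have : repr c \in repr d *: K.
    by rewrite -Ed -cK -[repr c]mulg1 mem_mulg // {2}Ec lcoset_refl.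
  move=> /lcosetP[k Kk ->].
  have Nk := subsetP sKN k Kk.
  by rewrite act_onM ?(fixv k Kk) ?NN.
rewrite sumr_const.
have -> : #|[pred c in lcosets H N | c * K == d]| = #|K : H|.
  rewrite -card_lcosets -(card_imset _ (@lcoset_inj gT (repr d))).
  apply: eq_card => c; rewrite inE; apply/andP/imsetP => [[Hc /eqP cK]|[B]].
    have [Nc Ec] := reprN H c sHN Hc.
    have : repr c \in repr d *: K.
      by rewrite -Ed -cK -[repr c]mulg1 mem_mulg // {2}Ec lcoset_refl.
    case/lcosetP=> k Kk Ek; exists (k *: H); last by rewrite -lcosetM -Ek.
    by apply/lcosetsP; exists k.
  case/lcosetsP=> k Kk -> ->; have Nk := subsetP sKN k Kk.
  rewrite -lcosetM; split; first by apply/lcosetsP; exists (repr d * k);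
    rewrite ?groupM.
  by rewrite -mulgA mulSGid // lcosetM lcoset_id // -Ed.
have /p_natP[[|m] Em] : p.-nat #|K : H|.
  exact: pnat_dvd (dvdn_indexg K H) (pgroupS sKN pN).
  by move: pHK; rewrite properE sHK -indexg_eq1 Em expn0 eqxx.
by rewrite Em expnS mulnC mulrnA -scaler_nat (pcharf0 (pchar_Fp p_pr)) scale0r.
Qed.

End Traces.

(** * Vanishing of the composition *)

Section Vanishing.

Variables (gT : finGroupType) (S : {group gT}) (F : fusion_system S).
Variables (p : nat) (Q : {group gT}) (n : nat).
Variable rV : mx_representation 'F_p (OutF F Q) n.
Variables (alpha : {group gT} -> gT -> gT) (X : {group gT} -> {set {group gT}}).
Hypotheses (p_pr : prime p) (pS : p.-group S) (choiceP : mackey_choice F Q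
  alpha X).
Implicit Types (P R T L M : {group gT}).

Let isoa L : fconj F Q L -> fiso F Q L (alpha L).
Proof. by case: choiceP => + _; apply. Qed.

Lemma mem_choice P L : P \subset S -> L \in X P -> L \subset P /\ fconj F Q L.
Proof.
move=> sPS XL; have [_ /(_ P sPS)/transversal_sub/subsetP/(_ L XL)] := choiceP.
by rewrite inE => /andP.
Qed.

Lemma conj_eltP R L M : M \in orbit 'JG%act R L ->
  conj_elt R L M \in R /\ L :^ (conj_elt R L M)^-1 = M.
Proof.
case/orbitP=> a Ra defM; rewrite /conj_elt;
  case: pickP => [r /andP[Rr /eqP Er]|/(_ a^-1)] //=.
by rewrite groupV Ra invgK -defM eqxx.
Qed.

Lemma trace_fixed P L v x : P \subset S -> L \in X P -> v \in tr_space rV alpha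
  L P ->
  x \in 'N_P(L) -> act_on rV alpha L x v = v.
Proof.
move=> sPS XL /imsetP[w _ ->] Nx; have [sLP cQL] := mem_choice sPS XL.
apply: (rtrace_fixed (H := L) (N := 'N_P(L)%G) isoa) => //.
- by rewrite setSI.
- by rewrite subsetI sLP normG.
by move=> y Ly; apply: act_on_inner.
Qed.

(** The product of L and C_P(L) acts trivially on the module and properly contains L, so
    [rtrace_eq0] applies to it. *)
Lemma tr_space_eq0 P L v : P \subset S -> L \in X P -> ~~ ('C_P(L) \subset L) ->
  v \in tr_space rV alpha L P -> v = 0%R.
Proof.
move=> sPS XL ncL /imsetP[w _ ->]; have [sLP cQL] := mem_choice sPS XL.
apply: (rtrace_eq0 (H := L) (K := (L <*> 'C_P(L))%G) (N :=
  'N_P(L)%G) isoa) => //.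
- by rewrite (pgroupS _ pS) // subIset ?sPS.
- by rewrite setSI.
- by rewrite properE joing_subl join_subG subxx.
- by rewrite join_subG subsetI sLP normG setIS ?cent_sub.
move=> x; rewrite /= norm_joinEr; last by rewrite subIset // cent_sub orbT.
case/mulsgP=> l c Ll /setIP[Pc cLc] ->;
  have [_ _ _ _ sLS] := fiso_props (isoa cQL).
have CSc : c \in 'C_S(L) by rewrite in_setI (subsetP sPS).
have NSc : c \in 'N_S(L) by apply: subsetP CSc; rewrite setIS ?cent_sub.
have NSl : l \in 'N_S(L) by rewrite in_setI (subsetP sLS) // (subsetP (normG
  L)).
by rewrite (act_onM rV isoa) // (act_on_cent rV isoa _ cQL CSc) (act_on_inner
  rV isoa).
Qed.

(** Invariance holds under all of N_P(M), not merely N_T(M): for M = r L r^-1, x r = r (x ^ r) moves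
    the action of x to an element of N_P(L), which fixes the trace [s L]. *)
Lemma Res_fixed P T M s x : P \subset S -> T \subset S -> M \in X T -> s \in
  SQV rV alpha X P ->
  x \in 'N_P(M) -> act_on rV alpha M x (Res rV alpha X P T s M) = Res rV alpha
    X P T s M.
Proof.
move=> sPS sTS XM; rewrite inE => /forallP sP Nx.
rewrite ffunE XM -[LHS]/(Iso rV alpha M M (lconj x) _) Iso_sum.
apply: eq_bigr => L /andP[XL orbM]; have [sLP cQL] := mem_choice sPS XL.
have := sP L; rewrite XL => sL.
have [Pr LrM] := conj_eltP orbM; set r := conj_elt P L M in Pr LrM *.
have sLS := subset_trans sLP sPS; have Sr := subsetP sPS r Pr.
have [Px nMx] := setIP Nx; have Sx := subsetP sPS x Px.
have isor : fiso F L M (lconj r).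
  by rewrite -(_ : (L :^ r^-1)%G = M) ?fiso_conj //; apply: val_inj.
have NLx : x ^ r \in 'N_P(L).
  by rewrite in_setI groupJ //= -(mem_conjgV 'N(L)) -normJ LrM.
have NSLx : x ^ r \in 'N_S(L) by apply: subsetP NLx; rewrite setSI.
have NSMx : x \in 'N_S(M) by apply: subsetP Nx; rewrite setSI.
have cQM : fconj F Q M.
  by apply: (fconj_trans cQL); apply/fconjP; exists (lconj r).
rewrite -{2}(trace_fixed sPS XL sL NLx).
rewrite -[act_on _ _ _ _ _]/(Iso rV alpha L L (lconj (x ^ r)) (s L)).
rewrite !(Iso_comp rV isoa) ?(fiso_norm isoa) //.
apply: (Iso_ext rV isoa) => // [|z _];
  first exact: fiso_comp isor (fiso_norm isoa cQM NSMx).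
by rewrite -[LHS]lconjM -[RHS]lconjM -conjgC.
Qed.

Lemma Ind_Res_eq0 P R s :
    P \subset S -> R \subset S -> s \in SQV rV alpha X P ->
    (forall M, M \subset P :&: R -> fconj F Q M -> 'C_P(M) \subset M ->
       exists x y, [/\ x \in 'N_P(M), y \in 'N_R(M),
         y \notin P & y * x^-1 \in 'C(M)]) ->
  Ind rV alpha X (P :&: R)%G R (Res rV alpha X P (P :&: R)%G s) = 0%R.
Proof.
move=> sPS sRS sP dich; have sTS : (P :&: R)%G \subset S by rewrite subIset
  ?sPS.
apply/ffunP=> M'; rewrite !ffunE; case: ifP => // XM';
  apply: big1 => M /andP[XM _].
have [sMT cQM] := mem_choice sTS XM.
have /andP[sMP sMR] : (M \subset P) && (M \subset R) by rewrite -subsetI.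
rewrite (_ : rtrace _ _ _ _ _ _ = 0%R) ?Iso0 //.
(* If C_P(M) is not in M, the same holds for every P-conjugate L of M, so all vectors contributing
   to the restriction at M are already zero. *)
have [cPM|ncPM] := boolP ('C_P(M) \subset M); last first.
  rewrite (_ : Res _ _ _ _ _ _ _ = 0%R).
    by apply: big1 => c _; exact: (Iso0 rV alpha M M).
  rewrite ffunE XM; apply: big1 => L /andP[XL orbM].
  have [Pr LrM] := conj_eltP orbM; set r := conj_elt P L M in Pr LrM *.
  rewrite (_ : s L = 0%R) ?Iso0 //.
  apply: (tr_space_eq0 sPS XL); last first.
    by move: sP; rewrite inE => /forallP/(_ L); rewrite XL.
  apply: contra ncPM => cPL;
    rewrite -LrM -{1}(conjGid (groupVr Pr)) centJ -conjIg.
  by rewrite conjSg.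
have [x [y [Nx Ny nPy cyx]]] := dich M sMT cQM cPM.
have fixNP u : u \in 'N_P(M) -> act_on rV alpha M u (Res rV alpha X P (P :&:
  R)%G s M) =
    Res rV alpha X P (P :&: R)%G s M by apply: Res_fixed.
have NSx : x \in 'N_S(M) by apply: subsetP Nx; rewrite setSI.
have NSy : y \in 'N_S(M) by apply: subsetP Ny; rewrite setSI.
have sNTR : 'N_(P :&: R)(M) \subset 'N_R(M) by rewrite setSI ?subsetIr.
(* N_T(M) fixes the restricted vector since it lies in N_P(M). So does y, which is x times an
   element centralizing M. As y is not in P, [<<A>>] is strictly larger than N_T(M). *)
pose A := 'N_(P :&: R)(M) :|: [set y].
have sAR : A \subset 'N_R(M) by rewrite subUset sNTR sub1set.
have sNRS : 'N_R(M) \subset 'N_S(M) by rewrite setSI.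
apply: (rtrace_eq0 isoa (H := 'N_(P :&: R)(M)%G) (K := (<<A>>)%G) (N :=
  'N_R(M)%G)) => //.
- by rewrite (pgroupS _ pS) // subIset ?sRS.
- rewrite properE sub_gen ?subsetUl //=; apply: contra nPy => /subsetP/(_ y).
  by rewrite mem_gen ?inE ?eqxx ?orbT // => /(_ isT)/andP[/andP[]].
- by rewrite gen_subG.
apply: (act_on_gen isoa cQM (subset_trans sAR sNRS)) => u /setUP[|/set1P->].
  by move=> Nu; apply: fixNP; apply: subsetP Nu; rewrite setSI ?subsetIl.
have CSyx : y * x^-1 \in 'C_S(M).
  have [[Sx _] [Sy _]] := (setIP NSx, setIP NSy).
  by rewrite in_setI cyx groupM ?groupV.
have NSyx : y * x^-1 \in 'N_S(M) by apply: subsetP CSyx;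
  rewrite setIS ?cent_sub.
rewrite -(mulgKV x y) (act_onM rV isoa) // (fixNP x Nx).
exact: act_on_cent isoa _ _ _ cQM CSyx.
Qed.

End Vanishing.

Theorem theorem2 (p : nat) (p_pr : prime p) (p_ge5 : (5 <= p)%N)
    (S : {group {'GL_8['F_p]}}) (sylS : p.-Sylow(G2 p) S)
    (F : fusion_system S) (satF : saturated F p)
    (Q : {group {'GL_8['F_p]}}) (sQS : Q \subset S) (ncQ : ~~ centric F Q)
    (n : nat) (rV : mx_representation 'F_p (OutF F Q) n)
    (irrV : mx_irreducible rV)
    (alpha : {group {'GL_8['F_p]}} -> {'GL_8['F_p]} -> {'GL_8['F_p]})
    (X : {group {'GL_8['F_p]}} -> {set {group {'GL_8['F_p]}}})
    (choiceP : mackey_choice F Q alpha X)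
    (P R : {group {'GL_8['F_p]}}) (sPS : P \subset S) (sRS : R \subset S)
    (cP : centric F P) (cR : centric F R) (ncT : ~~ centric F (P :&: R)%G) :
  forall s, s \in SQV rV alpha X P ->
    Ind rV alpha X (P :&: R)%G R (Res rV alpha X P (P :&: R)%G s) = 0%R.
Proof.
move=> s Ps.
have [C] := Sylow_coords p_pr (leq_trans (isT : 2 < 5)%N p_ge5) sylS.
apply: (Ind_Res_eq0 p_pr (S_pgroup C p_pr) choiceP sPS sRS Ps) => M sMT cQM.
have ncM : ~~ centric F M.
  by apply: contra ncQ; apply: fconj_centric; apply: fconj_sym.
apply: (@intersection_dichotomy p _ S C p_pr p_ge5 (centric F)) => //.
- exact: centric_cent.
- by move=> K L sKL sLS; apply: centric_sub.
- by move=> K g; apply: good_F_centric.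
by move=> K A; apply: abelian_F_centric.
Qed.
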